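(* For every integer $k \geq 2$ and every integer $t \geq k+1$ there is a constant $c=c(t,k)>1$ such that for every sequence of probabilities $p=p(n)\in[0,1]$ with $p(n)\geq \sqrt[k]{c/n}$ for all sufficiently large $n$, the random complex $X^k(n,p)$ asymptotically almost surely contains the complete $k$-complex $K_t^k$ as a topological minor, i.e. $\Pr[X^k(n,p)\text{ contains } K_t^k \text{ as a topological minor}]\to 1$ as $n\to\infty$.
   Context: A (finite abstract) simplicial complex is a finite set system closed under taking subsets; its members are called faces, and the dimension of a face $F$ is $|F|-1$. A $k$-complex is a $k$-dimensional simplicial complex. The random $k$-complex $X^k(n,p)$ has vertex set $[n]=\{1,\dots,n\}$, contains all subsets of $[n]$ of cardinality at most $k$ (complete $(k-1)$-skeleton), and each $F\in\binom{[n]}{k+1}$ is a face independently with probability $p$. The complete $k$-complex $K_t^k$ consists of all subsets of $[t]$ of cardinality at most $k+1$. A subdivision of a geometric simplicial complex $\Delta$ is a geometric simplicial complex $\Delta'$ with the same polyhedron (union of simplices), $\|\Delta'\|=\|\Delta\|$, such that every simplex of $\Delta'$ is contained in some simplex of $\Delta$. For abstract complexes, $X'$ is a subdivision of $X$ if there are geometric realizations $\Delta'$ of $X'$ and $\Delta$ of $X$ such that $\Delta'$ is a subdivision of $\Delta$. A complex $X$ has a complex $K$ as a topological minor if $X$ contains a subcomplex isomorphic to some subdivision of $K$. *)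

(* Defs.v *)
From HB Require Import structures.
From mathcomp Require Import all_boot all_order all_algebra finmap.
From mathcomp Require Import all_classical all_reals all_analysis.

Set Implicit Arguments.
Unset Strict Implicit.
Unset Printing Implicit Defensive.

Import Order.TTheory GRing.Theory Num.Theory.
Import numFieldNormedType.Exports.

Local Open Scope fset_scope.
Local Open Scope ring_scope.

(** A complex is a finite set system [X : {set {set V}}] over a finite type;
    elements of [V] lying in no face are not vertices of [X]. *)
Definition is_complex (V : finType) (X : {set {set V}}) : Prop :=
  forall F G : {set V}, F \in X -> G \subset F -> G \in X.

(** [finset.cover X] is the vertex set of [X]. *)
Definition isomorphic (V W : finType) (X : {set {set V}}) (Y : {set {set W}})
    : Prop :=
  exists f : V -> W, {in finset.cover X &, injective f} /\
    Y = (fun F : {set V} => f @: F)%SET @: X.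

Definition complete_complex (k t : nat) : {set {set 'I_t}} :=
  [set F : {set 'I_t} | (#|F| <= k.+1)%N]%SET.

Definition simplex (R : realType) (d : nat) (S : {fset 'rV[R]_d})
    : set 'rV[R]_d :=
  [set y | exists l : 'rV[R]_d -> R,
    [/\ forall x, x \in S -> 0 <= l x,
        \sum_(x <- S) l x = 1 &
        y = \sum_(x <- S) l x *: x]]%classic.

Definition affinely_independent (R : realType) (d : nat)
    (S : {fset 'rV[R]_d}) : Prop :=
  forall l : 'rV[R]_d -> R,
    \sum_(x <- S) l x = 0 -> \sum_(x <- S) l x *: x = 0 ->
    forall x, x \in S -> l x = 0.

(** A geometric simplicial complex is given by the vertex sets of its
    simplices; a simplex is determined by its vertex set, and its faces are
    the simplices spanned by subsets of that set. The empty simplex is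
    allowed, in accordance with the empty face of an abstract complex. *)
Definition is_geometric_complex (R : realType) (d : nat)
    (D : {fset {fset 'rV[R]_d}}) : Prop :=
  [/\ forall S, S \in D -> affinely_independent S,
      forall S T : {fset 'rV[R]_d}, S \in D -> T `<=` S -> T \in D &
      forall S T : {fset 'rV[R]_d}, S \in D -> T \in D ->
        exists U : {fset 'rV[R]_d},
          [/\ U `<=` S, U `<=` T &
              (simplex S `&` simplex T = simplex U)%classic]].

Definition polyhedron (R : realType) (d : nat) (D : {fset {fset 'rV[R]_d}})
    : set 'rV[R]_d :=
  [set y | exists2 S, S \in D & simplex S y]%classic.

Definition geometric_subdivision (R : realType) (d : nat)
    (D' D : {fset {fset 'rV[R]_d}}) : Prop :=
  polyhedron D' = polyhedron D /\
  forall S', S' \in D' ->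
    exists2 S, S \in D & (simplex S' `<=` simplex S)%classic.

(** The system of vertex sets of [D] is isomorphic to [X]. *)
Definition geometric_realization (R : realType) (d : nat)
    (D : {fset {fset 'rV[R]_d}}) (V : finType) (X : {set {set V}}) : Prop :=
  is_geometric_complex D /\
  exists f : V -> 'rV[R]_d, {in finset.cover X &, injective f} /\
    D = [fset [fset f v | v in F] | F : {set V} in X].

Definition subdivision (R : realType) (V' V : finType)
    (X' : {set {set V'}}) (X : {set {set V}}) : Prop :=
  exists (d : nat) (D' D : {fset {fset 'rV[R]_d}}),
    [/\ geometric_realization D' X', geometric_realization D X &
        geometric_subdivision D' D].

Definition topological_minor (R : realType) (V W : finType)
    (K : {set {set W}}) (X : {set {set V}}) : Prop :=
  exists Y : {set {set V}}, [/\ is_complex Y, Y \subset X &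
    exists (V' : finType) (K' : {set {set V'}}),
      [/\ is_complex K', subdivision R K' K & isomorphic K' Y]].

Definition top_faces (k n : nat) : {set {set 'I_n}} :=
  [set F : {set 'I_n} | #|F| == k.+1]%SET.

Definition skeleton_with (k n : nat) (Y : {set {set 'I_n}})
    : {set {set 'I_n}} :=
  ([set F : {set 'I_n} | (#|F| <= k)%N] :|: Y)%SET.

(** Probability that [X^k(n,p)] satisfies [A]: the sample space is the set of
    subsets [Y] of [top_faces k n], with the product Bernoulli weight. *)
Definition prob_random_complex (R : realType) (k n : nat) (p : R)
    (A : {set {set 'I_n}} -> Prop) : R :=
  \sum_(Y : {set {set 'I_n}} | (Y \subset top_faces k n) &&
                               `[< A (skeleton_with k Y) >])
    \prod_(F in top_faces k n) bernoulli_pmf p (F \in Y).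

(* Main.v *)
Require Import Defs.
From HB Require Import structures.
From mathcomp Require Import all_boot all_order all_algebra finmap.
From mathcomp Require Import all_classical all_reals all_analysis.
From mathcomp Require Import ring lra.

(** Let [F = w |: tau] be a facet of the complete complex. Subdividing it
    stellarly at [a1], then the remaining facet [a1 |: tau] at [a2], and so on
    along a path [w = a0, a1, .., am], replaces [F] by the join of the path
    with the boundary of [tau], together with [am |: tau]. Hence it suffices
    that [am |: tau] is a face and that for every edge [xy] of the path the
    [k] sets [(tau :\ u) :|: [set x; y]], [u \in tau], are faces.

    Edges of this kind are independent of each other and have probability
    [p ^+ k >= c / n]. An exploration from [w] in a pool of linearly many
    vertices reaches a positive fraction of the pool with probability at least
    [1/2]; since [p >= p ^+ k], one of the vertices reached forms a face with
    [tau] with conditional probability at least [3/4].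

    With disjoint pools for the facets, and with [k >= 2], the faces that
    matter for a facet of a copy of the [t] branch vertices meet both the copy
    and the pool of the facet. So facets of one copy, as well as disjoint
    copies sharing the same pools, are independent: every copy succeeds with
    probability bounded below by a positive constant, and among many copies
    one succeeds with probability close to [1]. *)

Set Implicit Arguments.
Unset Strict Implicit.
Unset Printing Implicit Defensive.

Import Order.TTheory GRing.Theory Num.Theory.
Import numFieldNormedType.Exports.

Local Open Scope fset_scope.
Local Open Scope ring_scope.

(** * Stellar subdivisions of geometric complexes *)

Section Simplices.
Context {R : realType} {d : nat}.
Implicit Types (S T G H U : {fset 'rV[R]_d}) (l : 'rV[R]_d -> R).

Lemma sum_const_fset G (c : R) : \sum_(x <- G) c = c * #|` G|%:R.
Proof. by rewrite big_const_seq count_predT iter_addr_0 mulr_natr. Qed.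

(** Coefficients may be taken nonnegative everywhere and zero off [G], so sums over a simplex and
    over one of its faces can be exchanged freely. *)
Lemma simplexP G y :
  simplex G y <-> exists l : 'rV[R]_d -> R,
    [/\ forall x, 0 <= l x, forall x, x \notin G -> l x = 0,
        \sum_(x <- G) l x = 1 & y = \sum_(x <- G) l x *: x].
Proof.
split=> [[l [l0 l1 ->]]|[l [l0 _ l1 ->]]]; last by exists l.
exists (fun x => if x \in G then l x else 0); split.
- by move=> x; case: ifP => // /l0.
- by move=> x /negbTE ->.
- by rewrite -l1 [LHS]big_seq [RHS]big_seq; apply: eq_bigr => x ->.
- by rewrite [LHS]big_seq [RHS]big_seq; apply: eq_bigr => x ->.
Qed.

Lemma simplexS G H : H `<=` G -> (simplex H `<=` simplex G)%classic.
Proof.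
move=> sHG y /simplexP [l [l0 lH l1 ->]]; apply/simplexP; exists l; split=> //.
- by move=> x xG; apply: lH; apply: contra xG; apply: (fsubsetP sHG).
- by rewrite -l1; symmetry; apply: big_fset_incl => // x _ /lH.
- by apply: big_fset_incl => // x _ /lH ->; rewrite scale0r.
Qed.

Lemma affine_coords_uniq G l l' : affinely_independent G ->
    \sum_(x <- G) l x = \sum_(x <- G) l' x ->
    \sum_(x <- G) l x *: x = \sum_(x <- G) l' x *: x ->
  {in G, l =1 l'}.
Proof.
move=> aG e1 e2 x xG; apply/eqP; rewrite -subr_eq0; apply/eqP.
apply: (aG (fun x => l x - l' x)) => //.
- by rewrite sumrB e1 subrr.
- under eq_bigr do rewrite scalerBl.
  by rewrite sumrB e2 subrr.
Qed.

Definition barycenter G : 'rV[R]_d := \sum_(g <- G) (#|` G|%:R)^-1 *: g.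

(* The coordinates over [G] of a combination [l] of the points of
   [barycenter G |` H], where [H `<=` G]. *)
Definition cone_coords G H l (g : 'rV[R]_d) : R :=
  l (barycenter G) / #|` G|%:R + (if g \in H then l g else 0).

Section Cone.
Variables (G H : {fset 'rV[R]_d}) (l : 'rV[R]_d -> R).
Hypotheses (sHG : H `<=` G) (bH : barycenter G \notin H) (G0 : (0 < #|` G|)%N).
Let b := barycenter G.

Let nG : #|` G|%:R != 0 :> R.
Proof. by rewrite pnatr_eq0 -lt0n. Qed.

Lemma sum_cone : \sum_(y <- b |` H) l y = \sum_(g <- G) cone_coords G H l g.
Proof.
rewrite big_fsetU1 //= big_split /=; congr (_ + _).
  by rewrite sum_const_fset divfK.
rewrite -(@big_fset_incl _ _ _ _ H G) // => [|z _ /negbTE -> //].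
by rewrite [LHS]big_seq [RHS]big_seq; apply: eq_bigr => z ->.
Qed.

Lemma comb_cone :
  \sum_(y <- b |` H) l y *: y = \sum_(g <- G) cone_coords G H l g *: g.
Proof.
rewrite big_fsetU1 //=; under [RHS]eq_bigr do rewrite scalerDl.
rewrite big_split /=; congr (_ + _).
  rewrite {2}/b /barycenter scaler_sumr.
  by apply: eq_bigr => g _; rewrite scalerA.
rewrite -(@big_fset_incl _ _ _ _ H G) // => [|z _ /negbTE ->]; last first.
  by rewrite scale0r.
by rewrite [LHS]big_seq [RHS]big_seq; apply: eq_bigr => z ->.
Qed.

Lemma cone_coords_ge0 : (forall x, 0 <= l x) ->
  forall g, 0 <= cone_coords G H l g.
Proof.
move=> l0 g; apply: addr_ge0; first by rewrite divr_ge0 // ler0n.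
by case: ifP.
Qed.

End Cone.

Lemma cone_coords_out G H l g : (0 < #|` G|)%N -> (forall x, 0 <= l x) ->
  cone_coords G H l g = 0 -> l (barycenter G) = 0.
Proof.
move=> G0 l0 /eqP; rewrite paddr_eq0; first last.
- by case: ifP.
- by rewrite divr_ge0 // ler0n.
by rewrite mulf_eq0 invr_eq0 pnatr_eq0 -[#|` G| == _]negbK -lt0n G0 orbF => /andP[/eqP].
Qed.

Lemma cone_subsimplex G H : H `<=` G -> barycenter G \notin H ->
  (0 < #|` G|)%N -> (simplex (barycenter G |` H)%fset `<=` simplex G)%classic.
Proof.
move=> sHG bH G0 y /simplexP [l [l0 _ l1 ->]].
exists (cone_coords G H l); split.
- by move=> x _; apply: cone_coords_ge0.
- by rewrite -sum_cone.
- by rewrite -comb_cone.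
Qed.

(** At a point of [G] outside [H] the coordinate over [G] is just [l (barycenter G) / #|G|]. It
    vanishes, so the barycenter has coefficient 0 and the rest follows over [H]. *)
Lemma cone_independent G H : affinely_independent G -> H `<` G ->
  barycenter G \notin H -> (0 < #|` G|)%N ->
  affinely_independent (barycenter G |` H).
Proof.
move=> aG pHG bH G0 l s0 v0.
have sHG := fproper_sub pHG.
move: s0 v0; rewrite sum_cone // comb_cone // => s0 v0.
have c0 := aG _ s0 v0.
have nG : #|` G|%:R != 0 :> R by rewrite pnatr_eq0 -lt0n.
have lb : l (barycenter G) = 0.
  move: pHG; rewrite fproperE => /andP[_ /fsubsetPn [g gG gH]].
  have := c0 g gG; rewrite /cone_coords (negbTE gH) addr0 => /eqP.
  by rewrite mulf_eq0 invr_eq0 (negbTE nG) orbF => /eqP.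
move=> x; rewrite in_fset1U => /orP[/eqP -> //|xH].
by have := c0 x (fsubsetP sHG _ xH); rewrite /cone_coords xH lb mul0r add0r.
Qed.

(** Let [g] have the least coordinate and subtract [l g] from every coordinate. The removed part is
    [l g * #|G|] times the barycenter; what remains is a nonnegative combination over [G] without
    [g]. *)
Lemma cone_cover G y : (0 < #|` G|)%N -> simplex G y -> barycenter G \notin G ->
  exists2 H, H `<` G & simplex (barycenter G |` H)%fset y.
Proof.
move=> G0 /simplexP[l [l0 lG l1 ->]] bG.
have [x0 x0G] : exists x, x \in G by apply/fset0Pn; rewrite -cardfs_gt0.
have nG : #|` G|%:R != 0 :> R by rewrite pnatr_eq0 -lt0n.
have [g gG gmin] : exists2 g, g \in G & forall x, x \in G -> l g <= l x.
  case: (@arg_minP _ R G [` x0G] xpredT (fun i => l (val i)) isT) => i _ imin.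
  exists (val i); first exact: valP.
  by move=> x xG; have := imin [` xG] isT.
exists (G `\ g); first by rewrite fproperD1.
have bH : barycenter G \notin G `\ g by rewrite in_fsetD1 negb_and bG orbT.
have sHG : G `\ g `<=` G by apply: fsubD1set.
pose m x := if x == barycenter G then l g * #|` G|%:R else l x - l g.
have cE : {in G, cone_coords G (G `\ g) m =1 l}.
  move=> x xG; rewrite /cone_coords /m eqxx mulfK // in_fsetD1 xG andbT.
  case: (altP (x =P g)) => [->|_] /=; first by rewrite addr0.
  have -> : (x == barycenter G) = false by apply: contraNF bG => /eqP <-.
  by rewrite addrC subrK.
exists m; split.
- move=> x; rewrite in_fset1U /m => /orP[/eqP ->|].
    by rewrite eqxx mulr_ge0 // ler0n.
  rewrite in_fsetD1 => /andP[_ xG]; case: ifP => _; first by rewrite mulr_ge0 // ler0n.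
  by rewrite subr_ge0 gmin.
- rewrite sum_cone // -l1 [LHS]big_seq [RHS]big_seq.
  by apply: eq_bigr => x /cE.
- rewrite comb_cone // [LHS]big_seq [RHS]big_seq.
  by apply: eq_bigr => x /cE ->.
Qed.

(** As [H1] and [H2] each miss a point of [G], the coefficient at the barycenter is [#|G|] times the
    least coordinate over [G]. Both representations of a common point therefore share it, hence
    agree, and are supported on the intersection. *)
Lemma cone_meet G H1 H2 : affinely_independent G -> H1 `<` G -> H2 `<` G ->
    barycenter G \notin G -> (0 < #|` G|)%N ->
  (simplex (barycenter G |` H1)%fset `&` simplex (barycenter G |` H2)%fset =
   simplex (barycenter G |` (H1 `&` H2))%fset)%classic.
Proof.
move=> aG pH1 pH2 bG G0.
have s1 := fproper_sub pH1; have s2 := fproper_sub pH2.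
have b1 : barycenter G \notin H1 by apply: contra bG; apply: (fsubsetP s1).
have b2 : barycenter G \notin H2 by apply: contra bG; apply: (fsubsetP s2).
have nG : 0 < #|` G|%:R^-1 :> R by rewrite invr_gt0 ltr0n.
apply/seteqP; split => y; last first.
  move=> yU; split; move: yU; apply: simplexS; apply: fsetUS.
  - exact: fsubsetIl.
  - exact: fsubsetIr.
move=> [/simplexP[l [l0 lo l1 ly]] /simplexP[m [m0 mo m1 my]]].
have e : {in G, cone_coords G H1 l =1 cone_coords G H2 m}.
  apply: affine_coords_uniq => //.
  - by rewrite -!sum_cone // l1 m1.
  - by rewrite -!comb_cone // -ly -my.
have eb : l (barycenter G) = m (barycenter G).
  have aux (K1 K2 : {fset 'rV[R]_d}) (f h : 'rV[R]_d -> R) : K1 `<` G ->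
      (forall x, 0 <= h x) -> {in G, cone_coords G K1 f =1 cone_coords G K2 h} ->
      h (barycenter G) <= f (barycenter G).
    rewrite fproperE => /andP[_ /fsubsetPn [g gG gK]] h0 /(_ g gG).
    rewrite /cone_coords (negbTE gK) addr0 => efh.
    by rewrite -(ler_pM2r nG) efh lerDl; case: ifP.
  apply/eqP; rewrite eq_le; apply/andP; split.
  - by apply: (aux H2 H1 m l) => // x xG; rewrite e.
  - exact: (aux H1 H2 l m).
have lm : {in G, forall g, (if g \in H1 then l g else 0) =
                           (if g \in H2 then m g else 0)}.
  by move=> g gG; have := e g gG; rewrite /cone_coords eb => /addrI.
have lout x : x \in barycenter G |` H1 -> x \notin barycenter G |` (H1 `&` H2) ->
    l x = 0.
  rewrite !in_fset1U !negb_or in_fsetI => /orP[/eqP -> /andP[/eqP //]|x1].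
  rewrite x1 andTb => /andP[_ x2]; have := lm x (fsubsetP s1 _ x1).
  by rewrite x1 (negbTE x2).
have sI : barycenter G |` (H1 `&` H2) `<=` barycenter G |` H1.
  by apply: fsetUS; apply: fsubsetIl.
exists l; split=> //.
- by rewrite -l1; apply: big_fset_incl.
- by rewrite ly; symmetry; apply: big_fset_incl => // x xx /(lout _ xx) ->; rewrite scale0r.
Qed.

(** * Stellar subdivision at the barycenter of a maximal simplex *)

Section StellarSubdivision.
Variables (D D' : {fset {fset 'rV[R]_d}}) (G : {fset 'rV[R]_d}).
Hypotheses (gD : is_geometric_complex D) (GD : G \in D)
  (Gmax : forall S, S \in D -> G `<=` S -> S = G) (G2 : (1 < #|` G|)%N).
Let b := barycenter G.
Hypothesis D'P : forall S, S \in D' <->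
  (S \in D /\ S <> G) \/ (exists2 H, H `<` G & S = b |` H).

Let G0 : (0 < #|` G|)%N.
Proof. exact: ltnW. Qed.

Let aG : affinely_independent G.
Proof. by case: gD => /(_ G GD). Qed.

(** By maximality of [G], the simplices of [S] and [G] meet in a proper face of [G], whereas all
    coordinates of the barycenter are positive. *)
Lemma barycenter_face S : S \in D -> S <> G -> ~ simplex S b.
Proof.
move=> SD SG Sb; case: gD => _ _ /(_ S G SD GD) [U [US UG E]].
have bG : simplex G b.
  exists (fun=> #|` G|%:R^-1); split=> //.
  by rewrite sum_const_fset mulVf // pnatr_eq0 -lt0n.
have : simplex U b by rewrite -E.
case/simplexP => l [l0 lU l1 lb].
have [g gG gU] : exists2 g, g \in G & g \notin U.
  apply/fsubsetPn; apply/negP => GU; apply: SG; apply: Gmax => //.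
  exact: fsubset_trans GU US.
suff : #|` G|%:R^-1 = l g :> R.
  by rewrite lU // => /eqP; rewrite invr_eq0 pnatr_eq0 -[_ == _]negbK -lt0n G0.
apply: (@affine_coords_uniq G (fun=> #|` G|%:R^-1) l) => //.
- rewrite sum_const_fset mulVf; last by rewrite pnatr_eq0 -lt0n.
  by rewrite -l1; apply: big_fset_incl => // x _ /lU.
- by rewrite -/(barycenter G) -/b lb; apply: big_fset_incl => // x _ /lU ->; rewrite scale0r.
Qed.

Lemma simplex_vertex S x : x \in S -> simplex S x.
Proof.
move=> xS; exists (fun y => (y == x)%:R); split.
- by move=> y _; rewrite ler0n.
- rewrite (big_fsetD1 x) //= eqxx big_seq big1 ?addr0 // => y.
  by rewrite in_fsetD1 => /andP[/negbTE ->].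
- rewrite (big_fsetD1 x) //= eqxx scale1r big_seq big1 ?addr0 // => y.
  by rewrite in_fsetD1 => /andP[/negbTE ->]; rewrite scale0r.
Qed.

Lemma barycenter_notin : b \notin G.
Proof.
apply/negP => bG.
have xD : [fset b] \in D.
  by case: gD => _ /(_ G [fset b] GD) + _; apply; rewrite fsub1set.
apply: (@barycenter_face [fset b]) => //; last by apply: simplex_vertex; rewrite inE.
by move=> E; move: G2; rewrite -E cardfs1.
Qed.

Lemma barycenter_new S : S \in D -> b \notin S.
Proof.
move=> SD; have [->|/eqP SG] := altP (S =P G); first exact: barycenter_notin.
by apply/negP => /simplex_vertex; apply: barycenter_face.
Qed.

Let bproper H : H `<` G -> b \notin H.
Proof. by move=> /fproper_sub /fsubsetP s; apply: contra barycenter_notin; apply: s. Qed.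

(** A point common to [S] and the cone lies in a proper face of [G], so some coordinate over [G] is
    0. Then its coefficient at [b] is 0, and it lies in the simplex of [H], a face of [D]. *)
Let face_meet_cone S H : S \in D -> S <> G -> H `<` G ->
  exists U : {fset 'rV[R]_d}, [/\ U `<=` S, U `<=` H &
    (simplex S `&` simplex (b |` H)%fset = simplex U)%classic].
Proof.
move=> SD SG pH; have [aD cD iD] := gD.
have sH := fproper_sub pH; have bH := bproper pH.
have [U [US UH E]] := iD S H SD (cD _ _ GD sH).
exists U; split=> //; rewrite -E; apply/seteqP; split => y [yS yH]; split=> //.
  have [U0 [U0S U0G E0]] := iD S G SD GD.
  have : simplex U0 y by rewrite -E0; split=> //; apply: cone_subsimplex yH.
  case/simplexP => m [m0 mU m1 my]; case/simplexP: yH => l [l0 lo l1 ly].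
  have [g gG gU] : exists2 g, g \in G & g \notin U0.
    apply/fsubsetPn; apply/negP => GU; apply: SG; apply: Gmax => //.
    exact: fsubset_trans GU U0S.
  have lb : l b = 0.
    apply: (@cone_coords_out G H l g) => //; rewrite -(mU g gU).
    apply: (@affine_coords_uniq G (cone_coords G H l) m) => //.
    - rewrite -sum_cone // l1 -m1; apply: big_fset_incl => // x _ /mU //.
    - rewrite -comb_cone // -ly my; apply: big_fset_incl => // x _ /mU ->.
      by rewrite scale0r.
  exists l; split=> //.
  - by move: l1; rewrite big_fsetU1 //= lb add0r.
  - by rewrite ly big_fsetU1 //= lb scale0r add0r.
by apply: simplexS yH; apply: fsubsetU1.
Qed.

Lemma stellar_geometric_complex : is_geometric_complex D'.
Proof.
have [aD cD iD] := gD; split.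
- move=> S /D'P [[SD _]|[H pH ->]]; first exact: aD.
  by apply: cone_independent => //; apply: bproper.
- move=> S T /D'P [[SD SG]|[H pH ->]] TS; apply/D'P.
    left; split; first exact: cD TS.
    by move=> TG; apply: SG; apply: Gmax; rewrite // -TG.
  have sTH : T `\ b `<=` H.
    apply/fsubsetP => x; rewrite in_fsetD1 => /andP[xb /(fsubsetP TS)].
    by rewrite in_fset1U (negbTE xb).
  have [bT|bT] := boolP (b \in T).
    by right; exists (T `\ b); [exact: fsub_proper_trans pH|rewrite fsetD1K].
  have pT : T `<` G by apply: fsub_proper_trans pH; rewrite -(mem_fsetD1 bT).
  left; split; first by apply: cD GD _; apply: fproper_sub.
  by move=> TG; move: pT; rewrite TG fproperEneq eqxx.
- move=> S T /D'P [[SD SG]|[H1 p1 ->]] /D'P [[TD TG]|[H2 p2 ->]].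
  + exact: iD.
  + have [U [U1 U2 E]] := face_meet_cone SD SG p2; exists U; split=> //.
    by apply: fsubset_trans U2 _; apply: fsubsetU1.
  + have [U [U1 U2 E]] := face_meet_cone TD TG p1; exists U; split=> //.
      by apply: fsubset_trans U2 _; apply: fsubsetU1.
    by rewrite setIC.
  + exists (b |` (H1 `&` H2)); split.
    * by apply: fsetUS; apply: fsubsetIl.
    * by apply: fsetUS; apply: fsubsetIr.
    * by apply: cone_meet => //; apply: barycenter_notin.
Qed.

Lemma stellar_subsimplex S : S \in D' ->
  exists2 T, T \in D & (simplex S `<=` simplex T)%classic.
Proof.
move=> /D'P [[SD _]|[H pH ->]]; first by exists S.
by exists G => //; apply: cone_subsimplex => //; [apply: fproper_sub|apply: bproper].
Qed.

Lemma stellar_polyhedron : polyhedron D' = polyhedron D.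
Proof.
apply/seteqP; split => y [S SD Sy].
  by have [T TD ST] := stellar_subsimplex SD; exists T => //; apply: ST.
have [SG|/eqP SG] := altP (S =P G); last by exists S => //; apply/D'P; left.
move: Sy; rewrite SG => /cone_cover [//||H pH Hy]; first exact: barycenter_notin.
by exists (b |` H) => //; apply/D'P; right; exists H.
Qed.

End StellarSubdivision.

End Simplices.

(** * Stellar subdivision of abstract complexes *)

Lemma in_cover {V : finType} (X : {set {set V}}) v :
  reflect (exists2 F, F \in X & v \in F) (v \in finset.cover X).
Proof. exact: finset.bigcupP. Qed.

Lemma fset_imageP {V : finType} {K : choiceType} (f : V -> K) (F : {set V}) x :
  reflect (exists2 v, v \in F & x = f v) (x \in [fset f v | v in F]).
Proof. exact: imfsetP. Qed.

Lemma perm_enum_finmem {V : finType} (F : {set V}) :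
  perm_eq (enum_finmem (mem F)) (enum F).
Proof.
apply: uniq_perm; rewrite ?enum_finmem_uniq ?enum_uniq //.
Qed.

(** For a maximal face [G] this is the stellar subdivision at a point [v] inside [G]: no face
    strictly contains [G], so only [G] itself is removed. *)
Definition stellar {V : finType} (K : {set {set V}}) (G : {set V}) (v : V)
    : {set {set V}} :=
  ((K :\ G) :|: [set v |: H | H in [set H : {set V} | H \proper G]])%SET.

Lemma stellarP {V : finType} (K : {set {set V}}) (G : {set V}) (v : V) F :
  F \in stellar K G v <->
  (F \in K /\ F <> G) \/ (exists2 H : {set V}, H \proper G & F = (v |: H)%SET).
Proof.
split.
  rewrite !inE => /orP[/andP[/eqP FG FK]|/finset.imsetP[H]]; first by left.
  by rewrite inE => pH ->; right; exists H.
case=> [[FK /eqP FG]|[H pH ->]]; first by rewrite !inE FG FK.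
by rewrite inE; apply/orP; right; apply/finset.imsetP; exists H; rewrite ?inE.
Qed.

Lemma stellar_complex {V : finType} (K : {set {set V}}) (G : {set V}) (v : V) :
    is_complex K -> G \in K -> (forall F, F \in K -> G \subset F -> F = G) ->
  is_complex (stellar K G v).
Proof.
move=> cK GK Gmax F T /stellarP [[FK FG]|[H pH ->]] TF; apply/stellarP.
  left; split; first exact: cK TF.
  by move=> TG; apply: FG; apply: Gmax => //; rewrite -TG.
have sTH : T :\ v \subset H.
  by rewrite subDset.
have pT := sub_proper_trans sTH pH.
have [vT|vT] := boolP (v \in T).
  by right; exists (T :\ v)%SET => //; rewrite finset.setD1K.
move: pT; rewrite (_ : (T :\ v)%SET = T); last first.
  by apply/finset.setDidPl; rewrite disjoint_sym disjoints1.
move=> pT; left; split; first by apply: cK GK (proper_sub pT).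
by move=> TG; move: pT; rewrite TG fintype.properxx.
Qed.

(** The realization of [K'] is extended by sending [v] to the barycenter of the image of [G]; the
    realization [D] of [K] stays the same. *)
Lemma subdivision_stellar {R : realType} {V W : finType} (K' : {set {set V}})
    (K : {set {set W}}) (G : {set V}) (v : V) :
    subdivision R K' K -> G \in K' ->
    (forall F, F \in K' -> G \subset F -> F = G) ->
    (1 < #|G|)%N -> v \notin finset.cover K' ->
  subdivision R (stellar K' G v) K.
Proof.
move=> [d [D' [D [[gD' [f [finj D'E]]] rD [pDD sDD]]]]] GK Gmax G2 vK.
pose im (F : {set V}) := [fset f u | u in F].
have memK F u : F \in K' -> u \in F -> u \in finset.cover K'.
  by move=> FK uF; apply/in_cover; exists F.
have imS F F' : F \in K' -> F' \in K' -> im F `<=` im F' -> F \subset F'.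
  move=> FK FK' /fsubsetP s; apply/fintype.subsetP => u uF.
  have /s /fset_imageP[w wF'] : f u \in im F by apply/fset_imageP; exists u.
  by move/finj => -> //; [apply: (memK F)|apply: (memK F')].
have imI F F' : F \in K' -> F' \in K' -> im F = im F' -> F = F'.
  by move=> FK FK' E; apply/eqP; rewrite finset.eqEsubset !imS // E.
have D'P S : S \in D' <-> exists2 F, F \in K' & S = im F.
  by rewrite D'E; split => [/fset_imageP|] // [F FK ->]; apply/fset_imageP; exists F.
pose b := barycenter (im G).
pose f' u := if u == v then b else f u.
pose im' (F : {set V}) := [fset f' u | u in F].
have im'E (F : {set V}) : v \notin F -> im' F = im F.
  move=> vF; apply/fsetP => x; apply/fset_imageP/fset_imageP => -[u uF ->];
    exists u => //; rewrite /f' ifF //; apply: contraNF vF => /eqP <- //.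
have vF F : F \in K' -> v \notin F.
  by move=> FK; apply: contra vK; apply: memK.
have vG := vF _ GK.
have im'U (H : {set V}) : H \subset G -> im' (v |: H)%SET = b |` im H.
  move=> HG; have vH : v \notin H by apply: contra vG; apply/fintype.subsetP.
  rewrite -(im'E _ vH); apply/fsetP => x; rewrite in_fset1U.
  apply/fset_imageP/orP.
    move=> [u]; rewrite !inE => /orP[/eqP -> ->|uH ->]; first by left; rewrite /f' eqxx.
    by right; apply/fset_imageP; exists u.
  move=> [/eqP ->|/fset_imageP[u uH ->]].
    by exists v; rewrite ?setU11 // /f' eqxx.
  by exists u => //; rewrite setU1r.
have GD : im G \in D' by apply/D'P; exists G.
have Gmax' S : S \in D' -> im G `<=` S -> S = im G.
  by move=> /D'P[F FK ->] /(imS _ _ GK FK) /Gmax ->.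
have cardG : #|` im G| = #|G|.
  rewrite card_in_imfset //=; first by rewrite cardE (perm_size (perm_enum_finmem G)).
  by move=> u w uG wG; apply: finj; apply: memK GK _.
have G2' : (1 < #|` im G|)%N by rewrite cardG.
pose D'' := [fset im' F | F in stellar K' G v].
have D''P S : S \in D'' <->
   (S \in D' /\ S <> im G) \/ (exists2 H, H `<` im G & S = b |` H).
  split.
    case/fset_imageP => F /stellarP [[FK FG] ->|[H pH -> ->]].
      left; rewrite im'E ?vF //; split; first by apply/D'P; exists F.
      by move/imI => E; apply: FG; apply: E.
    right; exists (im H); last by rewrite im'U // proper_sub.
    move: pH; rewrite fintype.properE fproperE => /andP[sH nH].
    apply/andP; split.
      apply/fsubsetP => x /fset_imageP[u uH ->]; apply/fset_imageP; exists u => //.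
      by apply: (fintype.subsetP sH).
    apply: contra nH => nH; apply/fintype.subsetP => u uG.
    have : f u \in im G by apply/fset_imageP; exists u.
    move/(fsubsetP nH)/fset_imageP => [w wH] /finj -> //; apply: memK GK _ => //.
    exact: (fintype.subsetP sH).
  move=> [[/D'P[F FK ->] FG]|[H pH ->]]; apply/fset_imageP.
    exists F; last by rewrite im'E // vF.
    by apply/stellarP; left; split=> // E; apply: FG; rewrite E.
  (* Proper faces of [im G] come from proper subsets of [G], recovered here as preimages under
     [f]. *)
  pose H0 := [set u in G | f u \in H]%SET.
  have HE : H = im H0.
    apply/fsetP => x; apply/idP/fset_imageP; last first.
      by move=> [u]; rewrite inE => /andP[_ ?] ->.
    move=> xH; have /fset_imageP[u uG xE] := fsubsetP (fproper_sub pH) _ xH.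
    by exists u; rewrite // inE uG -xE.
  have sH0 : H0 \subset G by apply/fintype.subsetP => u; rewrite inE => /andP[].
  exists (v |: H0)%SET; last by rewrite im'U // HE.
  apply/stellarP; right; exists H0 => //; rewrite finset.properEneq sH0 andbT.
  by apply: contraTneq pH => E; rewrite HE E fproperEneq eqxx.
exists d, D'', D; split=> //.
- split; first exact: (stellar_geometric_complex gD' GD Gmax' G2' D''P).
  exists f'; split=> //.
  have bnew u : u \in finset.cover K' -> f u <> b.
    move=> /in_cover[F FK uF] E.
    have FD : im F \in D' by apply/D'P; exists F.
    have /negP := barycenter_new gD' GD Gmax' G2' FD; apply.
    by rewrite -/b -E; apply/fset_imageP; exists u.
  have cov u : u \in finset.cover (stellar K' G v) -> u <> v -> u \in finset.cover K'.
    move=> /in_cover[F /stellarP[[FK _]|[H pH ->]] uF] uv; first exact: memK uF.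
    move: uF; rewrite !inE => /orP[/eqP //|uH]; apply: (memK _ _ GK).
    exact: (fintype.subsetP (proper_sub pH)).
  move=> u w /cov uc /cov wc; rewrite /f'.
  case: eqP => [->|uv]; case: eqP => [-> //|wv] E.
  + by case: (bnew w); rewrite ?E //; apply: wc.
  + by case: (bnew u); rewrite ?E //; apply: uc.
  + by apply: finj => //; [apply: uc|apply: wc].
- split; first by rewrite (stellar_polyhedron gD' GD Gmax' G2' D''P).
  move=> S /(stellar_subsimplex gD' GD Gmax' G2' D''P)[T /sDD[U UD TU] ST].
  by exists U => //; apply: subset_trans TU.
Qed.

(** * Realization by faces of the standard simplex *)

Section StandardSimplex.
Context {R : realType} {t : nat}.
Implicit Types (F : {set 'I_t}) (y : 'rV[R]_t).

Definition unit_vector (i : 'I_t) : 'rV[R]_t := delta_mx 0 i.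

Lemma unit_vectorE (i j : 'I_t) : unit_vector i 0 j = (j == i)%:R.
Proof. by rewrite mxE eqxx. Qed.

Lemma unit_vector_inj : injective unit_vector.
Proof.
move=> i j /rowP /(_ i); rewrite !unit_vectorE eqxx.
by case: eqP => // _ /eqP; rewrite oner_eq0.
Qed.

Lemma sum_unit_vectors (M : nmodType) F (g : 'rV[R]_t -> M) :
  \sum_(x <- [fset unit_vector i | i in F]) g x = \sum_(i in F) g (unit_vector i).
Proof.
rewrite big_imfset => [|i j _ _]; last exact: unit_vector_inj.
by rewrite (perm_big _ (perm_enum_finmem F)) big_enum.
Qed.

Lemma comb_unit_vectors F (l : 'rV[R]_t -> R) (i : 'I_t) :
  (\sum_(x <- [fset unit_vector j | j in F]) l x *: x) 0 i =
  if i \in F then l (unit_vector i) else 0.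
Proof.
rewrite sum_unit_vectors summxE.
under eq_bigr do rewrite mxE unit_vectorE.
rewrite big_mkcond /= (bigD1 i) //= eqxx mulr1 big1 ?addr0 // => j /negbTE ji.
by rewrite eq_sym ji mulr0; case: ifP.
Qed.

Lemma standard_simplexP F y :
  simplex [fset unit_vector i | i in F] y <->
  [/\ forall i, 0 <= y 0 i, forall i, i \notin F -> y 0 i = 0 &
      \sum_i y 0 i = 1].
Proof.
split=> [[l [l0 l1 ->]]|[y0 yF y1]].
  have lF i : i \in F -> 0 <= l (unit_vector i).
    by move=> iF; apply: l0; apply/fset_imageP; exists i.
  split=> [i|i iF|].
  - by rewrite comb_unit_vectors; case: ifP => // /lF.
  - by rewrite comb_unit_vectors (negbTE iF).
  - under eq_bigr do rewrite comb_unit_vectors.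
    by rewrite -big_mkcond /= -l1 sum_unit_vectors.
pose l (x : 'rV[R]_t) := \sum_i (x == unit_vector i)%:R * y 0 i.
have lE i : l (unit_vector i) = y 0 i.
  rewrite /l (bigD1 i) //= eqxx mul1r big1 ?addr0 // => j ji.
  by rewrite (inj_eq unit_vector_inj) eq_sym (negbTE ji) mul0r.
exists l; split.
- move=> x _; apply: sumr_ge0 => i _; apply: mulr_ge0 => //; exact: ler0n.
- rewrite sum_unit_vectors -y1 [LHS]big_mkcond /=; apply: eq_bigr => i _.
  by case: ifPn => [_|/yF -> //]; rewrite lE.
- apply/rowP => i; rewrite comb_unit_vectors lE.
  by case: ifPn => // /yF.
Qed.

Definition standard_realization (K : {set {set 'I_t}}) : {fset {fset 'rV[R]_t}} :=
  [fset [fset unit_vector i | i in F] | F : {set 'I_t} in K].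

Lemma standard_geometric_complex (K : {set {set 'I_t}}) :
  is_complex K -> is_geometric_complex (standard_realization K).
Proof.
move=> cK; split.
- move=> S /fset_imageP[F _ ->] l _ /rowP v0 x /fset_imageP[i iF ->].
  by have := v0 i; rewrite comb_unit_vectors iF mxE.
- move=> S T /fset_imageP[F FK ->] TS; apply/fset_imageP.
  exists [set i in F | unit_vector i \in T]%SET.
    by apply: (cK _ _ FK); apply/fintype.subsetP => i; rewrite inE => /andP[].
  apply/fsetP => x; apply/idP/fset_imageP => [xT|[i]]; last first.
    by rewrite inE => /andP[_ iT] ->.
  have /fset_imageP[i iF xE] := fsubsetP TS _ xT.
  by exists i; rewrite // inE iF -xE.
- move=> S T /fset_imageP[F FK ->] /fset_imageP[G GK ->].
  exists [fset unit_vector i | i in (F :&: G)%SET]; split.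
  + apply/fsubsetP => x /fset_imageP[i]; rewrite inE => /andP[iF _] ->.
    by apply/fset_imageP; exists i.
  + apply/fsubsetP => x /fset_imageP[i]; rewrite inE => /andP[_ iG] ->.
    by apply/fset_imageP; exists i.
  + apply/seteqP; split => y.
      move=> [/standard_simplexP[y0 yF y1] /standard_simplexP[_ yG _]].
      apply/standard_simplexP; split=> // i; rewrite inE negb_and.
      by move=> /orP[/yF|/yG].
    move=> /standard_simplexP[y0 yFG y1]; split; apply/standard_simplexP; split=> // i ni;
      by apply: yFG; rewrite inE negb_and ni ?orbT.
Qed.

End StandardSimplex.

Lemma complete_is_complex k t : is_complex (complete_complex k t).
Proof.
move=> F G; rewrite !inE => Fk GF; apply: leq_trans Fk; exact: subset_leq_card.
Qed.

(** The trivial subdivision, placed on the branch vertices: both sides have the standard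
    realization. The repair of facets starts from it. *)
Lemma subdivision_complete (R : realType) (k t : nat) (V : finType) (h : 'I_t -> V) :
  injective h ->
  subdivision R ((fun F : {set 'I_t} => h @: F) @: complete_complex k t)%SET
    (complete_complex k t).
Proof.
move=> injh; pose K := complete_complex k t.
have gK := standard_geometric_complex (R := R) (@complete_is_complex k t).
exists t, (standard_realization K), (standard_realization K); split; first last.
- by split=> // S SD; exists S.
- split=> //; exists unit_vector; split=> // i j _ _; exact: unit_vector_inj.
- split=> //.
  (* Elements outside the image of [h] lie in no face; 0 is a default value for them. *)
  pose f v : 'rV[R]_t := if [pick i | h i == v] is Some i then unit_vector i else 0.
  have fh i : f (h i) = unit_vector i.
    rewrite /f; case: pickP => [j /eqP /injh -> //|/(_ i)]; by rewrite eqxx.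
  exists f; split.
    move=> u v /in_cover[_ /finset.imsetP[F _ ->] /finset.imsetP[i _ ->]].
    move=> /in_cover[_ /finset.imsetP[G _ ->] /finset.imsetP[j _ ->]].
    by rewrite !fh => /unit_vector_inj ->.
  have imE (F : {set 'I_t}) :
      [fset f v | v in (h @: F)%SET] = [fset unit_vector i | i in F].
    apply/fsetP => x; apply/fset_imageP/fset_imageP.
      by move=> [_ /finset.imsetP[i iF ->] ->]; exists i; rewrite ?fh.
    by move=> [i iF ->]; exists (h i); rewrite ?fh // imset_f.
  apply/fsetP => S; apply/fset_imageP/fset_imageP.
    by move=> [F FK ->]; exists (h @: F)%SET; rewrite ?imE ?imset_f.
  by move=> [_ /finset.imsetP[F FK ->] ->]; exists F; rewrite ?imE.
Qed.

(** * Replacing facets by joins along paths *)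

Section Paths.
Context {R : realType} {V W : finType} (k : nat) (K : {set {set W}}).
Hypothesis k0 : (0 < k)%N.

(** The facets of the join of the edge [xy] with the boundary of [tau]. *)
Definition link_block (tau : {set V}) (x y : V) : {set {set V}} :=
  [set ((tau :\ u) :|: [set x; y])%SET | u in tau]%SET.

(* Only the target is required to lie in the pool [U]: a path may start at a
   branch vertex. *)
Definition link_adj (U tau : {set V}) (Y : {set {set V}}) : rel V :=
  fun x y => (y \in U) && (link_block tau x y \subset Y).

Definition linked (U tau : {set V}) (Y : {set {set V}}) (w : V) : bool :=
  [exists u, [&& u \in U, connect (link_adj U tau Y) w u & (u |: tau)%SET \in Y]].

Definition good_subdivision (K' : {set {set V}}) : Prop :=
  [/\ is_complex K', subdivision R K' K & forall F, F \in K' -> (#|F| <= k.+1)%N].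

(** A stellar subdivision of [G = a |: tau] at [b]. The new top faces replace one point [z] of [G]
    by [b]: [z = a] gives [b |: tau], and [z] in [tau] gives the link block of the edge [ab]. *)
Lemma path_step (K' : {set {set V}}) (tau : {set V}) (a b : V) :
    good_subdivision K' -> #|tau| = k -> a \notin tau -> (a |: tau)%SET \in K' ->
    b \notin finset.cover K' ->
  exists K'' : {set {set V}},
    [/\ good_subdivision K'', (b |: tau)%SET \in K'',
        forall v, v \in finset.cover K'' -> v = b \/ v \in finset.cover K',
        forall F, F \in K'' -> #|F| = k.+1 ->
          [\/ F \in K' /\ F <> (a |: tau)%SET, F \in link_block tau a b |
              F = (b |: tau)%SET] &
        forall F, F \in K' -> F <> (a |: tau)%SET -> F \in K''].
Proof.
move=> [cK sK dK] tk atau GK bK; set G := (a |: tau)%SET in GK *.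
have Gk : #|G| = k.+1 by rewrite /G cardsU1 atau tk.
have Gmax F : F \in K' -> G \subset F -> F = G.
  by move=> FK GF; apply/eqP; rewrite eq_sym finset.eqEcard GF Gk dK.
have bG : b \notin G by apply: contra bK => bG; apply/in_cover; exists G.
exists (stellar K' G b); split.
- split; first exact: stellar_complex.
    by apply: subdivision_stellar => //; rewrite Gk.
  move=> F /stellarP[[/dK //]|[H /proper_card + ->]]; rewrite Gk ltnS => Hk.
  by apply: leq_trans (_ : #|H|.+1 <= _)%N => //; rewrite cardsU1 -add1n leq_add2r leq_b1.
- apply/stellarP; right; exists tau => //; rewrite properEcard Gk tk ltnSn andbT.
  exact: finset.subsetUr.
- move=> v /in_cover[F /stellarP[[FK _]|[H /proper_sub sH ->]] vF].
    by right; apply/in_cover; exists F.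
  move: vF; rewrite !inE => /orP[/eqP -> |vH]; [by left|right].
  by apply/in_cover; exists G => //; apply: (fintype.subsetP sH).
- move=> F /stellarP[[FK FG] _|[H pH ->]]; first by constructor 1.
  have bH : b \notin H by apply: contra bG; apply/fintype.subsetP/proper_sub.
  rewrite cardsU1 bH add1n => -[Hk].
  have [z zG zH] : exists2 z, z \in G & z \notin H by have [] := properP pH.
  have HE : H = (G :\ z)%SET.
    have Gz : #|(G :\ z)%SET| = k by move: Gk; rewrite (cardsD1 z) zG add1n => -[].
    by apply/eqP; rewrite finset.eqEcard finset.subsetD1 zH proper_sub //= Gz Hk.
  rewrite HE; have [za|za] := altP (z =P a).
    by constructor 3; rewrite za /G setU1K.
  constructor 2; apply/finset.imsetP; exists z.
    by move: zG; rewrite !inE (negbTE za).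
  apply/finset.setP => x; rewrite !inE.
  have [->|xb] := altP (x =P b); first by rewrite orbT orbT.
  have [->|xa] := altP (x =P a) => //=; first by rewrite eq_sym za orbT.
  by rewrite orbF.
- by move=> F FK FG; apply/stellarP; left.
Qed.

(** Induction along the path: the facet [b |: tau] left by one step is the one that the next step
    subdivides. Each step adds the single vertex [b], so distinct path vertices stay new until they
    are used. *)
Lemma path_repair (Y : {set {set V}}) (U tau : {set V}) : #|tau| = k ->
  forall (s : seq V) (K' : {set {set V}}) (a : V),
    good_subdivision K' -> a \notin tau -> (a |: tau)%SET \in K' ->
    path (link_adj U tau Y) a s -> uniq s ->
    {in s, forall x, x \notin finset.cover K'} ->
  exists K'' : {set {set V}},
    [/\ good_subdivision K'',
        forall v, v \in finset.cover K'' -> v \in s \/ v \in finset.cover K',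
        forall F, F \in K'' -> #|F| = k.+1 ->
          [\/ F \in K' /\ F <> (a |: tau)%SET, F \in Y |
              F = (last a s |: tau)%SET] &
        forall F, F \in K' -> F <> (a |: tau)%SET -> F \in K''].
Proof.
move=> tk; elim=> [|b s IHs] K' a gK atau aK /=.
  move=> _ _ _; exists K'; split=> //; first by right.
  move=> F FK _; have [->|/eqP Fa] := altP (F =P (a |: tau)%SET); first by constructor 3.
  by constructor 1.
move=> /andP[/andP[_ /fintype.subsetP abY] ps] /andP[bs us] sK.
have bK : b \notin finset.cover K' by apply: sK; rewrite inE eqxx.
have btau : b \notin tau.
  apply: contra bK => bt; apply/in_cover; exists (a |: tau)%SET => //.
  by rewrite inE bt orbT.
have [K1 [gK1 bK1 cK1 tK1 kK1]] := path_step gK tk atau aK bK.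
have [|K2 [gK2 cK2 tK2 kK2]] := IHs K1 b gK1 btau bK1 ps us.
  move=> x xs; apply/negP => /cK1 [xb|]; first by move: bs; rewrite -xb xs.
  by apply/negP; apply: sK; rewrite inE xs orbT.
exists K2; split=> //.
- move=> v /cK2 [vs|/cK1 [->|?]]; last by right.
    by left; rewrite inE vs orbT.
  by left; rewrite inE eqxx.
- move=> F FK2 Fk; have [[FK1 Fb]|FY|->] := tK2 F FK2 Fk.
  + have [?|/abY ?|//] := tK1 F FK1 Fk; first by constructor 1.
    by constructor 2.
  + by constructor 2.
  + by constructor 3.
- move=> F FK Fa; apply: kK2; first exact: kK1.
  (* A face of [K'] cannot be the facet [b |: tau] consumed by the rest of the path, because [b] is
     new to [K']. *)
  move=> Fb; move/negP: bK; apply; apply/in_cover; exists F => //.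
  by rewrite Fb !inE eqxx.
Qed.

End Paths.

(** The facets are repaired one after another. Disjointness of the pools from each other and from
    the branch vertices makes the path for each facet consist of new vertices. *)
Lemma facets_repair (R : realType) (V : finType) (k t : nat) (h : 'I_t -> V)
    (U : {set 'I_t} -> {set V}) (Y : {set {set V}}) :
    (0 < k)%N -> injective h ->
    (forall F i, h i \notin U F) ->
    (forall F G v, v \in U F -> v \in U G -> F = G) ->
    (forall F : {set 'I_t}, #|F| = k.+1 -> exists2 w, w \in F &
       linked (U F) (h @: (F :\ w))%SET Y (h w)) ->
  exists K' : {set {set V}},
    good_subdivision (R := R) k (complete_complex k t) K' /\
    forall F, F \in K' -> #|F| = k.+1 -> F \in Y.
Proof.
move=> k0 injh hU UU link.
(* Here [s] lists the sets already treated: added vertices lie in their pools, and the facets not in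
   [s] are still intact. *)
suff /(_ (enum {set 'I_t}) (enum_uniq _)) : forall s : seq {set 'I_t}, uniq s ->
  exists K' : {set {set V}},
  [/\ good_subdivision (R := R) k (complete_complex k t) K',
      forall v, v \in finset.cover K' ->
        (exists i, v = h i) \/ (exists2 F, F \in s & v \in U F),
      forall F', F' \in K' -> #|F'| = k.+1 ->
        F' \in Y \/ (exists2 F, F \notin s & F' = (h @: F)%SET) &
      forall F : {set 'I_t}, #|F| = k.+1 -> F \notin s -> (h @: F)%SET \in K'].
  move=> [K' [gK' _ tK' _]]; exists K'; split=> // F FK Fk.
  by have [//|[G]] := tK' F FK Fk; rewrite mem_enum inE.
elim=> [_|F0 s IHs /= /andP[F0s us]].
  exists ((fun F : {set 'I_t} => h @: F) @: complete_complex k t)%SET; split.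
  - split; last 2 first.
    + exact: subdivision_complete.
    + by move=> _ /finset.imsetP[F + ->]; rewrite inE card_imset.
    move=> _ G /finset.imsetP[F FK ->] GF; apply/finset.imsetP.
    exists (F :&: h @^-1: G)%SET.
      by apply: (complete_is_complex FK); apply: finset.subsetIl.
    apply/finset.setP => v; apply/idP/finset.imsetP => [vG|[i]]; last first.
      by rewrite !inE => /andP[_ iG] ->.
    have /finset.imsetP[i iF vE] := fintype.subsetP GF v vG.
    by exists i; rewrite // !inE iF -vE.
  - move=> v /in_cover[_ /finset.imsetP[F _ ->] /finset.imsetP[i _ ->]].
    by left; exists i.
  - by move=> _ /finset.imsetP[F _ ->] _; right; exists F.
  - by move=> F Fk _; apply: imset_f; rewrite inE Fk.
have [K' [gK' cK' tK' kK']] := IHs us.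
have [F0k|F0k] := eqVneq #|F0| k.+1; last first.
  exists K'; split=> //.
  - move=> v /cK' [?|[F Fs vF]]; [by left|right; exists F => //].
    by rewrite inE Fs orbT.
  - move=> F' F'K F'k; have [?|[F Fs FE]] := tK' F' F'K F'k; [by left|right].
    exists F => //; rewrite inE negb_or Fs andbT.
    by apply: contra F0k => /eqP <-; rewrite -F'k FE card_imset.
  - by move=> F Fk; rewrite inE negb_or => /andP[_]; apply: kK'.
have [w wF /existsP[u /and3P[uU /connectP[p0 pp0 uE] uY]]] := link F0 F0k.
(* Cutting out loops makes the path vertices distinct, as each is used once as a subdivision
   point. *)
case/shortenP: pp0 uE => p pp /= /andP[_ up] _ uE.
set tau := (h @: (F0 :\ w))%SET in pp uY.
have tk : #|tau| = k.
  by rewrite card_imset //; move: F0k; rewrite (cardsD1 w) wF add1n => -[].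
have wtau : h w \notin tau by rewrite mem_imset // !inE eqxx.
have wtE : (h w |: tau)%SET = (h @: F0)%SET.
  by rewrite -[in RHS](finset.setD1K wF) imsetU1.
have wK : (h w |: tau)%SET \in K' by rewrite wtE kK'.
have pU x : x \in p -> x \in U F0.
  move: pp; clear; elim: p (h w) => //= y p IHp z /andP[/andP[yU _] /IHp pU].
  by rewrite inE => /orP[/eqP ->|/pU].
have pK : {in p, forall x, x \notin finset.cover K'}.
  move=> x /pU xU; apply/negP => /cK' [[i xi]|[F Fs xF]].
    by move: (hU F0 i); rewrite -xi xU.
  by move: F0s; rewrite (UU _ _ _ xU xF) Fs.
have [K2 [gK2 cK2 tK2 kK2]] := path_repair k0 tk gK' wtau wK pp up pK.
exists K2; split=> //.
- move=> v /cK2 [/pU vU|/cK' [?|[F Fs vF]]]; [right|by left|right].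
    by exists F0; rewrite // inE eqxx.
  by exists F; rewrite // inE Fs orbT.
- move=> F FK2 Fk; have [[FK FE]|?|->] := tK2 F FK2 Fk; [|by left|by left; rewrite -uE].
  have [?|[G Gs GE]] := tK' F FK Fk; [by left|right].
  exists G => //; rewrite inE negb_or Gs andbT; apply/eqP => GF0.
  by apply: FE; rewrite wtE GE GF0.
- move=> F Fk; rewrite inE negb_or => /andP[FF0 Fs].
  apply: kK2; first exact: kK'.
  by rewrite wtE => /(imset_inj injh) E; rewrite E eqxx in FF0.
Qed.

(** Faces with at most [k] vertices belong to the skeleton, so only the top faces are a matter of
    [Y]; the isomorphism is the identity. *)
Lemma topological_minor_skeleton (R : realType) (k t n : nat)
    (Y : {set {set 'I_n}}) (K' : {set {set 'I_n}}) :
    good_subdivision (R := R) k (complete_complex k t) K' ->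
    (forall F, F \in K' -> #|F| = k.+1 -> F \in Y) ->
  topological_minor R (complete_complex k t) (skeleton_with k Y).
Proof.
move=> [cK sK dK] KY; exists K'; split=> //.
  apply/fintype.subsetP => F FK; rewrite !inE.
  have := dK F FK; rewrite leq_eqVlt => /orP[/eqP /(KY _ FK) ->|]; first by rewrite orbT.
  by rewrite ltnS => ->.
exists 'I_n, K'; split=> //; exists id; split=> //.
apply/finset.setP => F; apply/idP/finset.imsetP => [FK|[G GK ->]].
  by exists F => //; rewrite imset_id.
by rewrite imset_id.
Qed.

Local Close Scope fset_scope.

(** * Product Bernoulli measures *)

Section Expectation.
Context {R : realType} {T : finType} (p : R).
Implicit Types (D Y : {set T}) (f g : {set T} -> R).

(** The mean of [f] at a random subset of [D] that contains each element independently with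
    probability [p]. *)
Definition expect D f : R :=
  \sum_(Y : {set T} | Y \subset D)
    (\prod_(x in D) bernoulli_pmf p (x \in Y)) * f Y.

Lemma set_U1_ind (P : {set T} -> Prop) :
  P finset.set0 -> (forall x D, x \notin D -> P D -> P (x |: D)%SET) ->
  forall D, P D.
Proof.
move=> P0 PU D; move: {2}#|D| (erefl #|D|) => n; elim: n D => [|n IHn] D Dn.
  by rewrite (cards0_eq Dn).
have /card_gt0P[x xD] : (0 < #|D|)%N by rewrite Dn.
rewrite -(finset.setD1K xD); apply: PU; first by rewrite !inE eqxx.
by apply: IHn; move: Dn; rewrite (cardsD1 x) xD add1n => -[].
Qed.

Lemma eq_expect D f g :
  (forall Y, Y \subset D -> f Y = g Y) -> expect D f = expect D g.
Proof. by move=> fg; apply: eq_bigr => Y /fg ->. Qed.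

Lemma expect_set0 f : expect finset.set0 f = f finset.set0.
Proof.
rewrite /expect (bigD1 finset.set0) ?fintype.subxx //= big_set0 mul1r big1 ?addr0 // => Y.
by rewrite finset.subset0 => /andP[/eqP ->]; rewrite eqxx.
Qed.

Lemma expectZ D c f : expect D (fun Y => c * f Y) = c * expect D f.
Proof. by rewrite /expect mulr_sumr; apply: eq_bigr => Y _; rewrite mulrCA. Qed.

Lemma expectD D f g : expect D (fun Y => f Y + g Y) = expect D f + expect D g.
Proof. by rewrite /expect -big_split; apply: eq_bigr => Y _; rewrite mulrDr. Qed.

Lemma expectU1 x D f : x \notin D ->
  expect (x |: D)%SET f =
  p * expect D (fun Y => f (x |: Y)%SET) + (1 - p) * expect D f.
Proof.
move=> xD; rewrite /expect (bigID (fun Y : {set T} => x \in Y)) /=; congr (_ + _).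
  rewrite mulr_sumr (reindex_onto (fun Y => x |: Y)%SET (fun Y => Y :\ x)%SET) /=.
    apply: eq_big => [Y|Y YD].
      rewrite setU11 andbT; apply/andP/idP => [[YD /eqP YE]|YD].
        move: YD; rewrite finset.subUset => /andP[_].
        rewrite -YE => YD; apply/fintype.subsetP => y yY.
        have := fintype.subsetP YD y yY; rewrite !inE => /orP[/eqP E|//].
        by move: yY; rewrite !inE E eqxx.
      have xY : x \notin Y by apply: contra xD; apply/fintype.subsetP.
      by rewrite finset.setUS // setU1K.
    rewrite big_setU1 //= setU11 mulrA; congr (_ * _ * _).
    apply: eq_bigr => y yD; rewrite !inE; case: eqP => // yx.
    by rewrite -yx yD in xD.
  by move=> Y /andP[_ xY]; rewrite finset.setD1K.
rewrite mulr_sumr; apply: eq_big => [Y|Y /andP[_ xY]].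
  apply/andP/idP => [[YD xY]|YD].
    apply/fintype.subsetP => y yY; have := fintype.subsetP YD y yY.
    by rewrite !inE => /orP[/eqP E|//]; rewrite -E yY in xY.
  have xY : x \notin Y by apply: contra xD; apply/fintype.subsetP.
  by split=> //; apply: fintype.subset_trans YD _; apply: subsetU1.
by rewrite big_setU1 //= (negbTE xY) mulrA.
Qed.

Lemma expect_cst D c : expect D (fun=> c) = c.
Proof.
elim/set_U1_ind: D => [|x D xD IH]; first by rewrite expect_set0.
by rewrite expectU1 // IH; ring.
Qed.

Lemma expectU D1 D2 f : [disjoint D1 & D2] ->
  expect (D1 :|: D2)%SET f =
  expect D1 (fun Y1 => expect D2 (fun Y2 => f (Y1 :|: Y2)%SET)).
Proof.
elim/set_U1_ind: D1 f => [|x D1 xD1 IH] f dD.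
  rewrite finset.set0U expect_set0.
  by apply: eq_expect => Y _; rewrite finset.set0U.
have [xD2 dD12] : x \notin D2 /\ [disjoint D1 & D2].
  by move: dD; rewrite finset.disjoints_subset finset.subUset finset.sub1set inE -finset.disjoints_subset => /andP[].
rewrite -finset.setUA !expectU1 //; last by rewrite inE negb_or xD1.
rewrite !IH //; congr (_ * _ + _).
apply: eq_expect => Y1 _; apply: eq_expect => Y2 _.
by rewrite finset.setUA.
Qed.

(** Reveals [D'] first and the rest of [D] afterwards; the exploration conditions on the past in
    this form. *)
Lemma expect_split D D' f : D' \subset D ->
  expect D f =
  expect D' (fun Y1 => expect (D :\: D')%SET (fun Y2 => f (Y1 :|: Y2)%SET)).
Proof.
move=> DD; rewrite -expectU; last first.
  rewrite finset.disjoints_subset; apply/fintype.subsetP => x xD.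
  by rewrite !inE xD.
by rewrite -{1}(finset.setID D D') (finset.setIidPr DD).
Qed.

Lemma expect_restrict D D' f : D' \subset D ->
  expect D (fun Y => f (Y :&: D')%SET) = expect D' f.
Proof.
move=> DD; rewrite (expect_split _ DD); apply: eq_expect => Y1 Y1D.
rewrite -[RHS](expect_cst (D :\: D')%SET); apply: eq_expect => Y2 Y2D.
congr f; rewrite finset.setIUl (finset.setIidPl Y1D).
apply/finset.setUidPl; apply: fintype.subset_trans (finset.sub0set Y1).
rewrite finset.subset0 setI_eq0; move: Y2D; rewrite finset.subsetD => /andP[_ //].
Qed.

(** Independence: each factor sees [Y] only on its own block, and the blocks are disjoint. *)
Lemma expect_prod_seq (I : eqType) (r : seq I) D (D_ : I -> {set T})
    (f : I -> {set T} -> R) : uniq r ->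
    {in r, forall i, D_ i \subset D} ->
    {in r &, forall i j, i != j -> [disjoint D_ i & D_ j]} ->
  expect D (fun Y => \prod_(i <- r) f i (Y :&: D_ i)%SET) =
  \prod_(i <- r) expect (D_ i) (f i).
Proof.
elim: r D => [|i r IH] D /=.
  by move=> _ _ _; rewrite big_nil -[RHS](expect_cst D); apply: eq_expect => Y _; rewrite big_nil.
move=> /andP[ir ur] sD dD.
have ri j : j \in r -> j \in i :: r by rewrite inE orbC => ->.
have ii : i \in i :: r by rewrite inE eqxx.
have dij j : j \in r -> [disjoint D_ j & D_ i].
  move=> jr; apply: dD => //; first exact: ri.
  by apply: contraNneq ir => <-.
rewrite big_cons -(IH (D :\: D_ i)%SET) //; first last.
- by move=> j l jr lr; apply: dD; apply: ri.
- by move=> j jr; rewrite finset.subsetD sD ?ri //= dij.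
rewrite (expect_split _ (sD i ii)) mulrC -expectZ; apply: eq_expect => Y1 Y1D.
rewrite mulrC -expectZ; apply: eq_expect => Y2 Y2D.
have Y2i : [disjoint Y2 & D_ i] by move: Y2D; rewrite finset.subsetD => /andP[].
rewrite big_cons; congr (f i _ * _).
  by rewrite finset.setIUl (finset.setIidPl Y1D) (disjoint_setI0 Y2i) finset.setU0.
rewrite [LHS]big_seq [RHS]big_seq; apply: eq_bigr => j jr.
rewrite finset.setIUl (disjoint_setI0 (_ : [disjoint Y1 & D_ j])) ?finset.set0U //.
by apply: disjointWl Y1D _; rewrite disjoint_sym dij.
Qed.

Lemma expect_prod (I : finType) (A : {set I}) D (D_ : I -> {set T})
    (f : I -> {set T} -> R) :
    {in A, forall i, D_ i \subset D} ->
    {in A &, forall i j, i != j -> [disjoint D_ i & D_ j]} ->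
  expect D (fun Y => \prod_(i in A) f i (Y :&: D_ i)%SET) =
  \prod_(i in A) expect (D_ i) (f i).
Proof.
move=> sD dD; rewrite -[RHS]big_enum /= -(@expect_prod_seq _ _ D) ?enum_uniq //.
- by apply: eq_expect => Y _; rewrite big_enum.
- by move=> i; rewrite mem_enum; apply: sD.
- by move=> i j; rewrite !mem_enum; apply: dD.
Qed.

Lemma expect_sup D : expect D (fun Y => (D \subset Y)%:R) = p ^+ #|D|.
Proof.
rewrite /expect (bigD1 D) ?fintype.subxx //= mulr1 [X in _ + X]big1 ?addr0.
  rewrite -[RHS]prodr_const. by apply: eq_bigr => x ->.
by move=> Y /andP[YD nYD]; move: nYD; rewrite finset.eqEsubset YD /= => /negbTE ->; rewrite mulr0.
Qed.

Lemma expect_empty D : expect D (fun Y => (Y == finset.set0)%:R) = (1 - p) ^+ #|D|.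
Proof.
rewrite /expect (bigD1 finset.set0) ?finset.sub0set //= eqxx mulr1 [X in _ + X]big1 ?addr0.
  by rewrite -[RHS]prodr_const; apply: eq_bigr => x _; rewrite inE.
by move=> Y /andP[_ /negbTE ->]; rewrite mulr0.
Qed.

Hypothesis p01 : 0 <= p <= 1.

Lemma le_expect D f g :
  (forall Y, Y \subset D -> f Y <= g Y) -> expect D f <= expect D g.
Proof.
move=> fg; apply: ler_sum => Y YD; apply: ler_wpM2l; last exact: fg.
by apply: prodr_ge0 => x _; apply: bernoulli_pmf_ge0.
Qed.

(** The number of blocks contained in [Y] is binomial with parameters [#|U|] and [p ^+ k]; this is
    its generating function at [rho]. *)
Lemma expect_star (V : finType) (k : nat) (b : V -> {set T}) (U : {set V}) D rho :
    {in U, forall u, b u \subset D} -> {in U, forall u, #|b u| = k} ->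
    {in U &, forall u v, u != v -> [disjoint b u & b v]} ->
  expect D (fun Y => rho ^+ #|[set u in U | b u \subset Y]|) =
  (1 - p ^+ k + p ^+ k * rho) ^+ #|U|.
Proof.
move=> bD bk bd.
transitivity (\prod_(u in U)
    expect (b u) (fun Y => if b u \subset Y then rho else 1)); last first.
  rewrite -[RHS]prodr_const; apply: eq_bigr => u uU; rewrite -(bk u uU).
  transitivity (expect (b u) (fun Y => 1 + (rho - 1) * (b u \subset Y)%:R)).
    by apply: eq_expect => Y _; case: (b u \subset Y) => /=; ring.
  by rewrite expectD expect_cst expectZ expect_sup; ring.
rewrite -(expect_prod _ bD bd); apply: eq_expect => Y _.
rewrite -prodr_const big_mkcond [RHS]big_mkcond /=; apply: eq_bigr => u _.
rewrite inE finset.subsetI fintype.subxx andbT; by case: (u \in U).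
Qed.

End Expectation.

(** * Exploration of the common link *)

Section LinkBlocks.
Context {V : finType}.
Implicit Types (tau U A : {set V}) (Y : {set {set V}}).

(** A face of a link block remembers its edge, so blocks of different edges are disjoint and hence
    independent. *)
Lemma link_block_setD tau x y H : x \notin tau -> y \notin tau ->
  H \in link_block tau x y -> (H :\: tau)%SET = [set x; y]%SET.
Proof.
move=> xt yt /finset.imsetP[u ut ->]; apply/finset.setP => z; rewrite !inE.
have [zt|zt] /= := boolP (z \in tau); last by rewrite andbF.
by symmetry; apply/negbTE; apply/negP => /orP[]/eqP zE; move: zt; rewrite zE ?(negbTE xt) ?(negbTE yt).
Qed.

Lemma card_link_block tau x y : x \notin tau -> y \notin tau ->
  #|link_block tau x y| = #|tau|.
Proof.
move=> xt yt; apply: card_in_imset => u v ut vt /finset.setP /(_ u).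
rewrite !inE eqxx ut andbT /=.
have [ux yu] : u != x /\ u != y by split; apply: contraTneq ut => ->.
by rewrite (negbTE ux) (negbTE yu) !orbF; case: eqP.
Qed.

Lemma link_block_disjoint tau x y x' y' :
    x \notin tau -> y \notin tau -> x' \notin tau -> y' \notin tau ->
    x \notin [set x'; y']%SET ->
  [disjoint link_block tau x y & link_block tau x' y'].
Proof.
move=> xt yt xt' yt' xx; rewrite finset.disjoints_subset.
apply/fintype.subsetP => H /(link_block_setD xt yt) E; rewrite inE.
apply/negP => /(link_block_setD xt' yt') E'; move: xx.
by rewrite -E' E !inE eqxx.
Qed.

Lemma link_blockC tau x y : link_block tau x y = link_block tau y x.
Proof. by apply: eq_imset => u; rewrite (finset.setUC [set x]%SET). Qed.

Definition reach U tau Y A : {set V} :=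
  [set u in U | [exists a in A, connect (link_adj U tau Y) a u]]%SET.

Lemma reachP U tau Y A u :
  reflect (u \in U /\ exists2 a, a \in A & connect (link_adj U tau Y) a u)
          (u \in reach U tau Y A).
Proof.
rewrite inE; apply: (iffP andP) => -[uU].
  by move=> /existsP[a /andP[aA au]]; split=> //; exists a.
by move=> [a aA au]; split=> //; apply/existsP; exists a; rewrite aA.
Qed.

Lemma link_adj_sub U U' tau Y Y' : U' \subset U -> Y' \subset Y ->
  subrel (link_adj U' tau Y') (link_adj U tau Y).
Proof.
move=> UU YY x y /andP[yU bY]; apply/andP; split.
  exact: (fintype.subsetP UU).
exact: fintype.subset_trans YY.
Qed.

Definition star U tau Y v : {set V} := [set u in U | link_block tau v u \subset Y]%SET.

(** One exploration step: [Y1] reveals the neighbours of [v], which then replace [v] among the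
    active vertices and leave the pool. An inclusion suffices, since only lower bounds on the
    reached set are wanted. *)
Lemma reach_step U tau Y1 Y2 A v : v \in A ->
  (star U tau Y1 v :|:
   reach (U :\: star U tau Y1 v) tau Y2 (A :\ v :|: star U tau Y1 v))%SET
  \subset reach U tau (Y1 :|: Y2)%SET A.
Proof.
move=> vA; set S := star U tau Y1 v.
have vS u : u \in S -> link_adj U tau (Y1 :|: Y2)%SET v u.
  rewrite inE /link_adj => /andP[-> uY] /=.
  by apply: fintype.subset_trans uY (finset.subsetUl _ _).
apply/fintype.subsetP => u; rewrite finset.in_setU => /orP[uS|].
  apply/reachP; split; first by move: uS; rewrite inE => /andP[].
  by exists v => //; apply/connect1/vS.
move=> /reachP[uU [a aA au]].
have au' : connect (link_adj U tau (Y1 :|: Y2)%SET) a u.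
  apply: connect_sub au => x y /link_adj_sub xy; apply/connect1/xy.
    exact: finset.subsetDl.
  exact: finset.subsetUr.
apply/reachP; split; first by move: uU; rewrite inE => /andP[].
move: aA; rewrite !inE => /orP[/andP[_ aA]|aS]; first by exists a.
exists v => //; apply: connect_trans au'; apply/connect1/vS.
by rewrite inE.
Qed.

End LinkBlocks.

Section Exploration.
Context {R : realType} {V : finType} (p : R) (k : nat) (tau : {set V}).
Hypotheses (p01 : 0 <= p <= 1) (tk : #|tau| = k).
Variable u0 : nat.
Hypothesis u0P : (1 - p ^+ k / 2) ^+ u0 <= 2^-1.

Let p0 : 0 <= p. Proof. by case/andP: p01. Qed.
Let p1 : p <= 1. Proof. by case/andP: p01. Qed.
Let base01 : 0 <= 1 - p ^+ k / 2 <= 1.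
Proof. by have := exprn_ge0 k p0; have := exprn_ile1 k p0 p1; lra. Qed.

(* Revealing the [N] neighbours in [U] of a vertex of [A] turns the bound into
   the mean of [2^-1 ^+ (#|A|.-1 + N)], and [2^-1 ^+ N] has mean
   [(1 - p ^+ k / 2) ^+ #|U| <= 2^-1] as long as [u0] vertices are unexplored. *)
Lemma explore (D : {set {set V}}) (A U : {set V}) (s : nat) :
    [disjoint A & U] -> [disjoint A :|: U & tau] ->
    (forall x y, x \in (A :|: U)%SET -> y \in U -> x != y ->
       link_block tau x y \subset D) ->
    (s + u0 <= #|U|)%N ->
  expect p D (fun Y => (#|reach U tau Y A| < s)%N%:R) <= 2^-1 ^+ #|A|.
Proof.
(* The measure drops by one in each step: [v] is discarded, while its neighbours only move from [U]
   to [A]. *)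
move: {2}(#|A| + #|U|)%N (leqnn (#|A| + #|U|)) => m.
elim: m A U D s => [|m IH] A U D s mAU AU AUt bD sU.
  have -> : #|A| = 0%N by move: mAU; rewrite leqn0 addn_eq0 => /andP[/eqP].
  rewrite expr0 -[leRHS](expect_cst p D); apply: le_expect => // Y _.
  by case: (_ < s)%N; rewrite ?lexx ?ler01.
have [->|[v vA]] := set_0Vmem A.
  rewrite cards0 expr0 -[leRHS](expect_cst p D); apply: le_expect => // Y _.
  by case: (_ < s)%N; rewrite ?lexx ?ler01.
have nt x : x \in (A :|: U)%SET -> x \notin tau.
  by move=> xAU; move: AUt => /disjointFr ->.
have vU : v \notin U by move: AU => /disjointFr ->.
have vnt : v \notin tau by apply: nt; rewrite inE vA.
have uv u : u \in U -> v != u by apply: contraTneq => <-.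
have Unt u : u \in U -> u \notin tau by move=> uU; apply: nt; rewrite inE uU orbT.
(* These faces decide the neighbours of [v]. Later edges avoid [v], so their blocks lie in
   [D :\: Dv] and are still unrevealed. *)
pose Dv := \bigcup_(u in U) link_block tau v u.
have DvD : Dv \subset D.
  by apply/bigcupsP => u uU; apply: bD; rewrite ?uv // inE vA.
rewrite (expect_split _ _ DvD).
have A1 : #|A| = #|(A :\ v)%SET|.+1 by rewrite (cardsD1 v) vA.
apply: (@le_trans _ _ (expect p Dv (fun Y1 =>
    2^-1 ^+ #|(A :\ v)%SET| * 2^-1 ^+ #|star U tau Y1 v|))).
  apply: le_expect => // Y1 Y1D; set S := star U tau Y1 v.
  have SU : S \subset U by apply/fintype.subsetP => u; rewrite inE => /andP[].
  (* With [s] neighbours the bad event is impossible; otherwise [s - #|S|] further vertices have to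
     be reached. *)
  have [sS|Ss] := leqP s #|S|.
    apply: (@le_trans _ _ 0); last by rewrite mulr_ge0 // exprn_ge0.
    rewrite -(expect_cst p (D :\: Dv)%SET 0); apply: le_expect => // Y2 _.
    rewrite ltnNge (_ : (s <= _)%N) //; apply: leq_trans sS _.
    apply: subset_leq_card; apply: fintype.subset_trans (reach_step _ _ _ _ vA).
    exact: finset.subsetUl.
  have AvS : [disjoint A :\ v & S].
    apply: disjointWl (finset.subsetDl _ _) _; exact: disjointWr SU AU.
  have cS : #|(A :\ v :|: S)%SET| = (#|(A :\ v)%SET| + #|S|)%N.
    by rewrite cardsU disjoint_setI0 // cards0 subn0.
  have cU : #|(U :\: S)%SET| = (#|U| - #|S|)%N.
    by rewrite cardsD (finset.setIidPr SU).
  have SleU := subset_leq_card SU.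
  rewrite -exprD -cS.
  apply: le_trans (IH (A :\ v :|: S)%SET (U :\: S)%SET (D :\: Dv)%SET (s - #|S|)%N _ _ _ _ _).
  - apply: le_expect => // Y2 _; rewrite ler_nat.
    have /subset_leq_card : (S :|: reach (U :\: S) tau Y2 (A :\ v :|: S))%SET \subset
       reach U tau (Y1 :|: Y2)%SET A by apply: reach_step.
    rewrite cardsU (_ : (S :&: _)%SET = finset.set0) ?cards0 ?subn0; last first.
      apply/finset.setP => u; rewrite !inE; apply/negbTE; apply/negP.
      by move=> /andP[uS /andP[/andP[+ _] _]]; rewrite uS.
    move=> le; case: (ltnP _ s) => // lts.
    by rewrite lt0b ltn_subRL; apply: leq_ltn_trans lts.
  - by rewrite cS cU -addnA subnKC // -ltnS -addSn -A1.
  - rewrite finset.disjoints_subset; apply/fintype.subsetP => u.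
    rewrite finset.in_setU finset.in_setD1 finset.in_setC finset.in_setD.
    case: (u \in S); rewrite ?orbT ?orbF //= => /andP[_ uA].
    by rewrite (disjointFr AU uA).
  - apply: disjointWl AUt; rewrite finset.subUset; apply/andP; split.
      rewrite finset.subUset; apply/andP; split.
        by apply: fintype.subset_trans (finset.subsetDl _ _) (finset.subsetUl _ _).
      by apply: fintype.subset_trans SU (finset.subsetUr _ _).
    by apply: fintype.subset_trans (finset.subsetDl _ _) (finset.subsetUr _ _).
  - move=> x y xAU yU xy.
    have yU' : y \in U by move: yU; rewrite inE => /andP[].
    have [xAU' xv] : x \in (A :|: U)%SET /\ v != x.
      have SU' := fintype.subsetP SU x.
      move: xAU; rewrite !inE.
      case/orP => [/orP[/andP[xv xA]|xS]|/andP[_ xU]].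
      + by rewrite xA eq_sym.
      + have xU : x \in U by apply: SU'; rewrite inE.
        by rewrite xU orbT uv.
      + by rewrite xU orbT uv.
    rewrite finset.subsetD bD //= disjoint_sym finset.disjoints_subset.
    apply/bigcupsP => u uU; rewrite -finset.disjoints_subset.
    apply: link_block_disjoint; rewrite ?vnt ?(nt _ xAU') ?Unt //.
    by rewrite !inE negb_or xv uv.
  - by rewrite cU -(leq_add2r #|S|) subnK // addnAC subnK // ltnW.
rewrite expectZ /star (@expect_star _ _ _ _ k (link_block tau v)); first last.
- move=> u w uU wU uw; rewrite (link_blockC _ v u).
  apply: link_block_disjoint; rewrite ?vnt ?Unt //.
  by rewrite !inE negb_or eq_sym uv.
- by move=> u uU; rewrite card_link_block ?vnt ?Unt.
- move=> u uU; apply/fintype.subsetP => H Hu; apply/finset.bigcupP; by exists u.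
rewrite A1 exprSr; apply: ler_wpM2l; first by rewrite exprn_ge0.
have -> : 1 - p ^+ k + p ^+ k * 2^-1 = 1 - p ^+ k / 2 by field.
apply: le_trans u0P; case/andP: base01 => b0 b1.
by apply: ler_wiXn2l => //; apply: leq_trans sU; apply: leq_addl.
Qed.

(** Failure has two causes: fewer than [s] vertices are reached, with probability at most [1/2], or
    none of at least [s] reached vertices forms a face with [tau], with probability at most [1/4].
    The faces [u |: tau] are set apart in [DB] and revealed last. *)
Lemma linked_lower_bound (D : {set {set V}}) (U : {set V}) (w : V) (s : nat) :
    w \notin U -> w \notin tau -> [disjoint U & tau] ->
    (forall x y, x \in (w |: U)%SET -> y \in U -> x != y ->
       link_block tau x y \subset D) ->
    (forall u, u \in U -> (u |: tau)%SET \in D) ->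
    (s + u0 <= #|U|)%N -> (1 - p) ^+ s <= 4^-1 ->
  4^-1 <= expect p D (fun Y => (linked U tau Y w)%:R).
Proof.
move=> wU wt Ut bD tD sU sP.
suff : expect p D (fun Y => (~~ linked U tau Y w)%:R) <= 2^-1 + 4^-1.
  have : expect p D (fun Y => (linked U tau Y w)%:R + (~~ linked U tau Y w)%:R) = 1.
    rewrite -[RHS](expect_cst p D); apply: eq_expect => Y _.
    by case: (linked _ _ _ _); rewrite /= ?addr0 ?add0r.
  rewrite expectD; lra.
have nt u : u \in U -> u \notin tau by move=> uU; rewrite (disjointFr Ut).
pose DB := [set (u |: tau)%SET | u in U]%SET.
have DBD : DB \subset D by apply/fintype.subsetP => _ /finset.imsetP[u uU ->]; apply: tD.
have D1D : (D :\: DB)%SET \subset D by apply: finset.subsetDl.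
have D2 : (D :\: (D :\: DB))%SET = DB by rewrite finset.setDDr finset.setDv finset.set0U (finset.setIidPr DBD).
rewrite (expect_split _ _ D1D) D2.
apply: (@le_trans _ _ (expect p (D :\: DB)%SET (fun Y1 =>
    (#|reach U tau Y1 [set w]| < s)%N%:R + 4^-1))).
  apply: le_expect => // Y1 _; set S := reach _ _ _ _.
  have [Ss|sS] := ltnP #|S| s.
    apply: (@le_trans _ _ 1); last by rewrite lerDl invr_ge0.
    rewrite -[leRHS](expect_cst p DB); apply: le_expect => // Y2 _.
    by case: (linked _ _ _ _) => /=; rewrite ?ler01 ?lexx.
  rewrite add0r; apply: le_trans sP.
  pose C := [set (u |: tau)%SET | u in S]%SET.
  have SU : S \subset U by apply/fintype.subsetP => u /reachP[].
  have CD : C \subset DB by apply: imsetS.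
  have cC : #|C| = #|S|.
    apply: card_in_imset => u u' /(fintype.subsetP SU) uU _ /finset.setP /(_ u).
    by rewrite !inE eqxx (negbTE (nt u uU)) !orbF => /esym /eqP.
  apply: (@le_trans _ _ ((1 - p) ^+ #|C|)); last first.
    by apply: ler_wiXn2l; rewrite ?cC ?subr_ge0 ?gerBl ?p0 ?p1.
  rewrite -expect_empty -(expect_restrict _ _ CD); apply: le_expect => // Y2 Y2D.
  case: (altP (_ =P finset.set0)) => [_|/finset.set0Pn[H]].
    by case: (linked _ _ _ _) => /=; rewrite ?ler01 ?lexx.
  rewrite inE => /andP[HY /finset.imsetP[u /reachP[uU [a]]]].
  rewrite inE => /eqP -> wu HE.
  rewrite (_ : linked _ _ _ _) //; apply/existsP; exists u; rewrite uU inE -HE HY orbT andbT /=.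
  by apply: connect_sub wu => x y /(link_adj_sub (fintype.subxx U) (finset.subsetUl _ _)) /connect1.
rewrite expectD expect_cst lerD2r.
apply: le_trans (explore (s := s) (A := [set w]%SET) _ _ _ _) _.
- by rewrite finset.disjoints_subset finset.sub1set inE.
- rewrite finset.disjoints_subset finset.subUset finset.sub1set inE wt /=.
  by rewrite -finset.disjoints_subset.
(* Faces in link blocks have two vertices outside [tau] and those in [DB] have one, so the
   exploration never reveals [DB]. *)
- move=> x y xU yU xy; rewrite finset.subsetD bD //= finset.disjoints_subset.
  have xt : x \notin tau by move: xU; rewrite !inE => /orP[/eqP -> //|/nt].
  apply/fintype.subsetP => H /(link_block_setD xt (nt _ yU)) E; rewrite inE.
  apply/negP => /finset.imsetP[u uU HE]; move: xy.
  have E' : (H :\: tau)%SET = [set u]%SET.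
    rewrite HE; apply/finset.setP => z; rewrite !inE.
    by have [->|] := altP (z =P u); [rewrite nt|case: (z \in tau)].
  have := E; rewrite E' => /finset.setP E2.
  have := E2 x; have := E2 y; rewrite !inE !eqxx orbT /= => /eqP -> /eqP ->.
  by rewrite eqxx.
- exact: sU.
- by rewrite cards1 expr1.
Qed.

End Exploration.

(** * Disjoint copies *)

Lemma linked_mono (V : finType) (U tau : {set V}) (Y Y' : {set {set V}}) (w : V) :
  Y' \subset Y -> linked U tau Y' w -> linked U tau Y w.
Proof.
move=> YY /existsP[u /and3P[uU wu uY]]; apply/existsP; exists u.
rewrite uU (fintype.subsetP YY _ uY) andbT /=.
by apply: connect_sub wu => x y /(link_adj_sub (fintype.subxx U) YY) /connect1.
Qed.

Lemma card_link_face (V : finType) (tau : {set V}) (x y : V) (H : {set V}) :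
    x \notin tau -> y \notin tau -> x != y -> H \in link_block tau x y ->
  #|H| = #|tau|.+1.
Proof.
move=> xt yt xy HB; rewrite -(cardsID tau) (link_block_setD xt yt HB) cards2 xy.
case/finset.imsetP: HB => u ut ->.
have -> : ((tau :\ u :|: [set x; y]) :&: tau)%SET = (tau :\ u)%SET.
  apply/finset.setP => z; rewrite !inE.
  have [zt|zt] /= := boolP (z \in tau); last by rewrite !andbF.
  rewrite !andbT; case: eqP => //= _; case: eqP => [zx|_].
    by move: zt; rewrite zx (negbTE xt).
  by case: eqP => [zy|_] //; move: zt; rewrite zy (negbTE yt).
by rewrite (cardsD1 u tau) ut addn2.
Qed.

(** * Independent blocks of faces for the facets of disjoint copies *)

Section Blocks.
Context {R : realType} (k t M m n : nat).
(** The layout in ['I_n]: [M] copies of the branch vertices, and one pool of size [m] for each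
    subset of ['I_t], shared by all copies. *)
Variable h : 'I_M * 'I_t + {set 'I_t} * 'I_m -> 'I_n.
Hypothesis injh : injective h.
Hypothesis k2 : (2 <= k)%N.

Let branch (j : 'I_M) (i : 'I_t) : 'I_n := h (inl (j, i)).
Let pool (F : {set 'I_t}) : {set 'I_n} := [set h (inr (F, x)) | x : 'I_m]%SET.

Let branch_inj j : injective (branch j).
Proof. by move=> i i' /injh[]. Qed.

Let branch_pool j i F : branch j i \notin pool F.
Proof. by apply/negP => /finset.imsetP[x _ /injh]. Qed.

Let pool_inj F G v : v \in pool F -> v \in pool G -> F = G.
Proof. by move=> /finset.imsetP[x _ ->] /finset.imsetP[y _ /injh[]]. Qed.

Let card_pool F : #|pool F| = m.
Proof. by rewrite card_imset ?card_ord // => x y /injh[]. Qed.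

(* The faces on which [facet_linked j F] depends. *)
Definition local_faces (j : 'I_M) (F : {set 'I_t}) : {set {set 'I_n}} :=
  [set H : {set 'I_n} | [&& #|H| == k.+1, [exists v in H, v \in pool F],
     [exists i, branch j i \in H] &
     H \subset (pool F :|: branch j @: 'I_t)%SET]]%SET.

(** A pool vertex of a local face determines [F], and a branch vertex determines the copy [j]. *)
Lemma local_faces_disjoint j j' F F' :
  (j, F) != (j', F') -> [disjoint local_faces j F & local_faces j' F'].
Proof.
move=> jF; rewrite finset.disjoints_subset; apply/fintype.subsetP => H.
rewrite !inE => /and4P[_ /existsP[v /andP[vH vF]] /existsP[i iH] _].
apply/negP => /and4P[_ _ _ /fintype.subsetP sH]; move: jF.
have := sH v vH; rewrite inE => /orP[/(pool_inj vF) ->|]; last first.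
  by move=> /finset.imsetP[i' _ vE]; move: vF; rewrite vE (negbTE (branch_pool _ _ _)).
have := sH _ iH; rewrite inE (negbTE (branch_pool _ _ _)) /=.
by move=> /finset.imsetP[i' _ /injh[-> _]]; rewrite eqxx.
Qed.

Lemma local_faces_top j F : local_faces j F \subset top_faces k n.
Proof. by apply/fintype.subsetP => H; rewrite !inE => /and4P[]. Qed.

Definition facet_linked (j : 'I_M) (F : {set 'I_t}) (Y : {set {set 'I_n}}) : bool :=
  (#|F| == k.+1) ==>
  [exists w in F, linked (pool F) (branch j @: (F :\ w))%SET Y (branch j w)].

(** A pool of size at least [2u] allows the exploration to reach [u] vertices while [u] unexplored
    ones remain, that is, [s = u0 = u]. *)
Lemma facet_linked_prob (p : R) (u : nat) (j : 'I_M) (F : {set 'I_t}) :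
    0 <= p <= 1 -> (u + u <= m)%N ->
    (1 - p ^+ k / 2) ^+ u <= 2^-1 -> (1 - p) ^+ u <= 4^-1 ->
  4^-1 <= expect p (local_faces j F) (fun Y => (facet_linked j F Y)%:R).
Proof.
move=> p01 um u2 u4; rewrite /facet_linked.
have [Fk|Fk] := eqVneq #|F| k.+1; last first.
  by rewrite /= expect_cst; lra.
have /card_gt0P[w wF] : (0 < #|F|)%N by rewrite Fk.
set tau := (branch j @: (F :\ w))%SET.
have tk : #|tau| = k.
  by rewrite card_imset //; move: Fk; rewrite (cardsD1 w) wF add1n => -[].
have wt : branch j w \notin tau by rewrite mem_imset // !inE eqxx.
have Ut : [disjoint pool F & tau].
  rewrite finset.disjoints_subset; apply/fintype.subsetP => v vF; rewrite inE.
  by apply/negP => /finset.imsetP[i _ vE]; move: vF; rewrite vE (negbTE (branch_pool _ _ _)).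
have tsub : tau \subset (branch j @: 'I_t)%SET by apply: imsetS; apply/fintype.subsetP.
apply: (@le_trans _ _ (expect p (local_faces j F)
    (fun Y => (linked (pool F) tau Y (branch j w))%:R))).
  apply: (linked_lower_bound p01 tk u2) u4 => //.
  - move=> x y xU yU xy; apply/fintype.subsetP => H HB.
    have yt : y \notin tau by rewrite (disjointFr Ut).
    have xt : x \notin tau by move: xU; rewrite !inE => /orP[/eqP -> //|xU]; rewrite (disjointFr Ut).
    rewrite inE (card_link_face xt yt xy HB) tk eqxx /=.
    case/finset.imsetP: HB => z zt ->; apply/and3P; split.
    + by apply/existsP; exists y; rewrite yU !inE eqxx !orbT.
    (* Here [k >= 2] enters: after the loss of [z] the face still contains a branch vertex, which
       ties it to copy [j]. *)
    + have : (0 < #|(tau :\ z)%SET|)%N.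
        by move: tk k2; rewrite (cardsD1 z) zt => <-.
      move=> /card_gt0P[v]; rewrite !inE => /andP[vz vt].
      case/finset.imsetP: (vt) => i _ vE; apply/existsP; exists i.
      by rewrite -vE !inE vz vt.
    + rewrite finset.subUset; apply/andP; split.
        apply: fintype.subset_trans (finset.subsetUr _ _).
        by apply: fintype.subset_trans tsub; apply: finset.subsetDl.
      apply/fintype.subsetP => v; rewrite !inE => /orP[/eqP ->|/eqP ->]; last first.
        by rewrite yU.
      move: xU; rewrite !inE => /orP[/eqP ->|-> //].
      by rewrite imset_f ?orbT.
  - move=> v vU; have vt : v \notin tau by rewrite (disjointFr Ut).
    rewrite inE cardsU1 vt tk add1n eqxx /=; apply/and3P; split.
    + by apply/existsP; exists v; rewrite vU !inE eqxx.
    + have /card_gt0P[x xt] : (0 < #|tau|)%N by rewrite tk ltnW.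
      case/finset.imsetP: (xt) => i _ xE; apply/existsP; exists i.
      by rewrite -xE !inE xt orbT.
    + rewrite finset.subUset finset.sub1set inE vU /=.
      exact: fintype.subset_trans tsub (finset.subsetUr _ _).
  - by rewrite card_pool.
apply: le_expect => // Y _; rewrite /= ler_nat.
case: (boolP (linked _ _ _ _)) => // lw; rewrite lt0b.
by apply/existsP; exists w; rewrite wF.
Qed.

(** Restricting [Y] to the local faces makes the events for different facets independent; by
    monotonicity of [linked] they still give links in [Y]. *)
Definition copy_linked (j : 'I_M) (Y : {set {set 'I_n}}) : bool :=
  [forall F, facet_linked j F (Y :&: local_faces j F)%SET].

Lemma copy_linked_minor (j : 'I_M) (Y : {set {set 'I_n}}) :
  copy_linked j Y ->
  topological_minor R (complete_complex k t) (skeleton_with k Y).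
Proof.
move=> /forallP cl.
have [] := @facets_repair R _ k t (branch j) pool Y (ltnW k2).
- exact: branch_inj.
- by [].
- exact: pool_inj.
- move=> F Fk; have := cl F; rewrite /facet_linked Fk eqxx /=.
  move=> /existsP[w /andP[wF lw]]; exists w => //.
  by apply: linked_mono lw; apply: finset.subsetIl.
- by move=> K' [gK' K'Y]; apply: topological_minor_skeleton gK' K'Y.
Qed.

(** Independence is used twice: over the facets of a copy, which succeeds with probability at least
    [4^-1] to the number of subsets of ['I_t], and over the [M] copies, which must all fail if there
    is no minor. *)
Lemma minor_prob (p : R) (u : nat) :
    0 <= p <= 1 -> (u + u <= m)%N ->
    (1 - p ^+ k / 2) ^+ u <= 2^-1 -> (1 - p) ^+ u <= 4^-1 ->
  1 - (1 - 4^-1 ^+ #|{set 'I_t}|) ^+ M <=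
  prob_random_complex k p (fun X : {set {set 'I_n}} =>
    topological_minor R (complete_complex k t) X) <= 1.
Proof.
move=> p01 um u2 u4.
set A := topological_minor R (complete_complex k t).
have -> : prob_random_complex k p A =
    expect p (top_faces k n) (fun Y => (`[< A (skeleton_with k Y) >])%:R).
  rewrite /prob_random_complex big_mkcondr /=; apply: eq_bigr => Y _.
  by case: (`[< _ >]); rewrite ?mulr1 ?mulr0.
apply/andP; split; last first.
  rewrite -[leRHS](expect_cst p (top_faces k n)); apply: le_expect => // Y _.
  by case: (`[< _ >]); rewrite ?ler01 ?lexx.
pose D j := \bigcup_(F : {set 'I_t}) local_faces j F.
have LD j F : local_faces j F \subset D j.
  by apply/fintype.subsetP => H HF; apply/finset.bigcupP; exists F.
(* The indicator that copy [j] fails, written so that it depends only on the faces in [D j]. *)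
pose g j Y : R := 1 - \prod_(F in [set: {set 'I_t}]%SET)
  (facet_linked j F (Y :&: local_faces j F)%SET)%:R.
have gE j Y : g j (Y :&: D j)%SET = (~~ copy_linked j Y)%:R.
  rewrite /g; under eq_bigr => F _.
    rewrite -finset.setIA (finset.setIidPr (LD j F)); over.
  have [/forallP cl|] := boolP (copy_linked j Y).
    by rewrite big1 ?subrr // => F _; rewrite cl.
  rewrite negb_forall => /existsP[F nF]; rewrite (bigD1 F) ?inE //=.
  by rewrite (negbTE nF) mul0r subr0.
have sD : {in [set: 'I_M]%SET, forall j, D j \subset top_faces k n}.
  by move=> j _; apply/bigcupsP => F _; apply: local_faces_top.
have dD : {in [set: 'I_M]%SET &, forall j j', j != j' -> [disjoint D j & D j']}.
  move=> j j' _ _ jj; rewrite finset.disjoints_subset; apply/bigcupsP => F _.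
  rewrite -finset.disjoints_subset disjoint_sym finset.disjoints_subset.
  apply/bigcupsP => F' _; rewrite -finset.disjoints_subset.
  by apply: local_faces_disjoint; apply: contra jj => /eqP[->].
apply: (@le_trans _ _ (1 - expect p (top_faces k n)
    (fun Y => \prod_(j in [set: 'I_M]%SET) g j (Y :&: D j)%SET))); last first.
  rewrite lerBlDr -expectD -[leLHS](expect_cst p (top_faces k n)).
  apply: le_expect => // Y _.
  have [/existsP[j cj]|] := boolP [exists j, copy_linked j Y].
    have -> : `[< A (skeleton_with k Y) >] by apply/asboolP/copy_linked_minor/cj.
    rewrite lerDl; apply: prodr_ge0 => i _; rewrite gE; exact: ler0n.
  rewrite negb_exists => /forallP nc; rewrite [X in _ + X]big1 ?lerDr ?ler0n // => j _.
  by rewrite gE nc.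
rewrite lerD2l lerN2 expect_prod //.
have -> : (1 - 4^-1 ^+ #|{set 'I_t}|) ^+ M =
    \prod_(j in [set: 'I_M]%SET) (1 - 4^-1 ^+ #|{set 'I_t}|) :> R.
  by rewrite prodr_const cardsT card_ord.
apply: ler_prod => j _; apply/andP; split.
  rewrite -(expect_restrict _ _ (sD j (finset.in_setT j))) -(expect_cst p (top_faces k n) 0).
  by apply: le_expect => // Y _; rewrite gE ler0n.
rewrite /g expectD expect_cst lerD2l.
under eq_expect do rewrite -mulN1r.
rewrite expectZ mulN1r lerN2.
rewrite (@expect_prod _ _ _ _ _ (D j) (local_faces j)
  (fun F Y => (facet_linked j F Y)%:R)) //; last first.
  by move=> F F' _ _ FF; apply: local_faces_disjoint; apply: contra FF => /eqP[->].
rewrite -cardsT -prodr_const; apply: ler_prod => F _.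
by rewrite invr_ge0 ler0n /= (facet_linked_prob (u := u)).
Qed.

End Blocks.

(** * Bounds for powers of [1 - x] *)

(** The induction step is [(1 - x) * (1 + (n + 1) * x) <= 1 + n * x]. *)
Lemma bernoulli_exp_le {R : realType} (x : R) (n : nat) : 0 <= x <= 1 ->
  (1 - x) ^+ n * (1 + n%:R * x) <= 1.
Proof.
move=> x01; elim: n => [|n IH]; first by rewrite expr0 mul0r addr0 mulr1.
apply: le_trans IH; rewrite exprSr -mulrA; apply: ler_wpM2l.
  by rewrite exprn_ge0 // subr_ge0; case/andP: x01.
have : 0 <= n%:R :> R by rewrite ler0n.
rewrite -natr1; nra.
Qed.

Lemma exp_le_bernoulli {R : realType} (x e : R) (n : nat) :
  0 <= x <= 1 -> 0 <= e -> 1 <= e * (1 + n%:R * x) -> (1 - x) ^+ n <= e.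
Proof.
move=> x01 e0 enx.
have y0 : 0 <= (1 - x) ^+ n by rewrite exprn_ge0 // subr_ge0; case/andP: x01.
apply: le_trans (ler_peMr y0 enx) _; rewrite mulrCA -[leRHS]mulr1.
by apply: ler_wpM2l => //; apply: bernoulli_exp_le.
Qed.

(** From [n * q >= 3] come [1 + n * q / 2 >= 2] and [1 + n * p >= 4]; the second inequality is what
    asks for 3. *)
Lemma exp_bounds {R : realType} (q p : R) (n : nat) :
    0 <= q -> q <= p -> p <= 1 -> 3 <= n%:R * q ->
  (1 - q / 2) ^+ n <= 2^-1 /\ (1 - p) ^+ n <= 4^-1.
Proof.
move=> q0 qp p1 nq; split; apply: exp_le_bernoulli; rewrite ?invr_ge0 //.
- by apply/andP; split; lra.
- lra.
- by apply/andP; split; lra.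
- have : n%:R * q <= n%:R * p by rewrite ler_wpM2l.
  lra.
Qed.

(** * Choice of the constants and passage to the limit *)

Local Open Scope classical_set_scope.
Local Open Scope ring_scope.

Theorem theorem1 (R : realType) (k t : nat) (hk : (2 <= k)%N)
    (ht : (k.+1 <= t)%N) :
  exists c : R, 1 < c /\
    forall p : nat -> R,
      (forall n, 0 <= p n <= 1) ->
      (\forall n \near \oo, (c / n%:R) `^ (k%:R^-1) <= p n) ->
      prob_random_complex k (p n)
        (fun X : {set {set 'I_n}} =>
           topological_minor R (complete_complex k t) X)
        @[n --> \oo] --> (1 : R).
Proof.
(* Each of the [2 ^ t] pools has [2 * u] vertices, [n / 2 ^ (t + 3) <= u], and
   the constant makes [u * p ^+ k] at least [3]. *)
exists (3 * 2 ^+ (t + 3)); split.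
  have : 1 <= 2 ^+ (t + 3) :> R by rewrite exprn_ege1 // ler1n.
  lra.
move=> p p01 pc; apply/cvgrPdist_le => e e0.
pose x : R := 4^-1 ^+ #|{set 'I_t}|.
have x0 : 0 < x by rewrite exprn_gt0 // invr_gt0.
have x1 : x <= 1 by rewrite exprn_ile1 // ?invr_ge0 //; lra.
(* Then [M * x * e > 1], so [(1 - x) ^+ M <= 1 / (1 + M * x) <= e]. *)
pose M := Num.bound (x * e)^-1.
have Me : (1 - x) ^+ M <= e.
  have MP : (x * e)^-1 < M%:R by rewrite archi_boundP // invr_ge0 mulr_ge0 // ltW.
  have xe : 1 < M%:R * (x * e) by rewrite -ltr_pdivrMr ?mulr_gt0 // mul1r.
  apply: exp_le_bernoulli; rewrite ?(ltW x0) ?x1 ?ltW //; lra.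
near=> n.
have n0 : (2 ^ (t + 2) <= n)%N by near: n; apply: nbhs_infty_ge.
(* One half of the vertices has room for the [M * t] branch vertices; the other holds the [2 ^ t]
   pools of size [2 * u], as [u <= n / 2 ^ (t + 2)]. *)
have nM : (2 * (M * t) <= n)%N by near: n; apply: nbhs_infty_ge.
have pn : (3 * 2 ^+ (t + 3) / n%:R) `^ (k%:R^-1) <= p n by near: n.
have n0' : 0 < n%:R :> R by rewrite ltr0n; apply: leq_trans n0; rewrite expn_gt0.
have /andP[p0 p1] := p01 n.
have k0 : (0 < k)%N by apply: ltnW.
have pk : 3 * 2 ^+ (t + 3) / n%:R <= p n ^+ k.
  have c0 : 0 <= 3 * 2 ^+ (t + 3) / n%:R :> R.
    by rewrite divr_ge0 ?ler0n // mulr_ge0 // exprn_ge0.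
  have -> : 3 * 2 ^+ (t + 3) / n%:R =
      ((3 * 2 ^+ (t + 3) / n%:R) `^ (k%:R^-1)) ^+ k :> R.
    rewrite -powR_mulrn ?powR_ge0 // -powRrM mulVf ?powRr1 //.
    by rewrite pnatr_eq0 -lt0n.
  by apply: lerXn2r; rewrite // nnegrE ?powR_ge0.
pose u := (n %/ 2 ^ (t + 2))%N.
have un : (u * 2 ^ (t + 2) <= n)%N by apply: leq_trunc_div.
have u1 : (0 < u)%N by rewrite divn_gt0 ?expn_gt0.
(* As [u >= 1], rounding down costs at most a factor 2: [n < (u + 1) * 2 ^ (t + 2) <= 2 * u * 2 ^ (t
   + 2)]. *)
have nu : (n <= 2 ^ (t + 3) * u)%N.
  have : (n < u.+1 * 2 ^ (t + 2))%N by rewrite -ltn_divLR ?expn_gt0.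
  move=> /ltnW /leq_trans; apply.
  have -> : (2 ^ (t + 3) = 2 * 2 ^ (t + 2))%N by rewrite -expnS -addnS.
  rewrite -mulnA mulnCA [leqLHS]mulnC leq_mul2l; apply/orP; right.
  by rewrite mul2n -addnn -add1n leq_add2r.
have pp : p n ^+ k <= p n.
  by rewrite -{2}(expr1 (p n)); apply: ler_wiXn2l.
have up : 3 <= u%:R * p n ^+ k.
  apply: le_trans (_ : u%:R * (3 * 2 ^+ (t + 3) / n%:R) <= _); last first.
    by apply: ler_wpM2l; rewrite ?ler0n.
  rewrite mulrA ler_pdivlMr // mulrCA -natrX -!natrM ler_nat leq_mul2l /=.
  by rewrite mulnC.
have q0 : 0 <= p n ^+ k by rewrite exprn_ge0.
have [u2 u4] := exp_bounds q0 pp p1 up.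
have [h injh] : exists h : 'I_M * 'I_t + {set 'I_t} * 'I_(u + u) -> 'I_n, injective h.
  have cn : (#|{: 'I_M * 'I_t + {set 'I_t} * 'I_(u + u)}| <= n)%N.
    rewrite card_sum !card_prod !card_ord -cardsT -finset.powersetT card_powerset.
    rewrite cardsT card_ord -(leq_pmul2l (isT : 0 < 2)%N) mulnDr mul2n -addnn.
    rewrite [leqRHS]mul2n -addnn; apply: leq_add; first by rewrite addnn -mul2n.
    apply: leq_trans un; rewrite addn2 !expnS.
    have -> : (2 * (2 ^ t * (u + u)) = u * (2 * (2 * 2 ^ t)))%N by ring.
    by [].
  exists (fun y => widen_ord cn (enum_rank y)) => y z /(congr1 val) /= E.
  by apply: enum_rank_inj; apply: val_inj.
have /andP[l1 l2] := minor_prob (R := R) injh hk (p01 n) (leqnn (u + u)) u2 u4.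
rewrite ger0_norm ?subr_ge0 //.
apply: le_trans Me; rewrite lerBlDr addrC -lerBlDr; exact: l1.
Unshelve. all: by end_near.
Qed.
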